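(* Let $N \geq 2$ and let $\phi,\psi \in \mathrm{IA}_N(\mathbb{Z}/3\mathbb{Z})$. Suppose that there exists an integer $k \geq 1$ such that $\phi^k=\psi^k$. Then $\phi=\psi$.
   Context: $F_N$ denotes a nonabelian free group of rank $N$, $\mathrm{Out}(F_N)$ its outer automorphism group, and $\mathrm{IA}_N(\mathbb{Z}/3\mathbb{Z})$ is the kernel of the natural homomorphism $\mathrm{Out}(F_N) \to \mathrm{Aut}(H_1(F_N,\mathbb{Z}/3\mathbb{Z}))$. *)

(* Defs.v *)
From mathcomp Require Import all_boot all_algebra.
Set Implicit Arguments. Unset Strict Implicit. Unset Printing Implicit Defensive.
Import GRing.Theory Num.Theory.

(* A letter x_i^{+1} is (i, false); x_i^{-1} is (i, true). *)
Definition letter (N : nat) : Type := ('I_N * bool)%type.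

Definition inv_letter N (a : letter N) : letter N := (a.1, ~~ a.2).

Definition reduce_cons N (a : letter N) (w : seq (letter N)) : seq (letter N) :=
  match w with
  | b :: w' => if b == inv_letter a then w' else a :: w
  | [::] => [:: a]
  end.

(* free reduction of a word: the canonical element of F_N it represents *)
Definition reduce N (w : seq (letter N)) : seq (letter N) :=
  foldr (@reduce_cons N) [::] w.

Definition fmul N (u v : seq (letter N)) : seq (letter N) := reduce (u ++ v).
Definition finv N (w : seq (letter N)) : seq (letter N) :=
  rev (map (@inv_letter N) w).

Definition gen N (i : 'I_N) : seq (letter N) := [:: (i, false)].

(* an endomorphism of F_N is given by the images of the basis elements *)
Definition endo (N : nat) : Type := 'I_N -> seq (letter N).

Definition apply N (s : endo N) (w : seq (letter N)) : seq (letter N) :=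
  reduce (flatten (map (fun a : letter N => if a.2 then finv (s a.1) else s a.1) w)).

Definition comp N (s t : endo N) : endo N := fun i => apply s (t i).
Definition id_endo N : endo N := @gen N.
Definition power N (s : endo N) (k : nat) : endo N := iter k (comp s) (@id_endo N).

Definition is_aut N (s : endo N) : Prop :=
  exists t : endo N, forall i : 'I_N,
    apply s (t i) = gen i /\ apply t (s i) = gen i.

(* s and t define the same element of Out(F_N): they differ by an inner automorphism *)
Definition out_eq N (s t : endo N) : Prop :=
  exists g : seq (letter N), forall i : 'I_N,
    reduce (s i) = fmul (fmul g (reduce (t i))) (finv g).

(* exponent sum of x_j in a word (its j-th coordinate in H_1(F_N; Z)) *)
Definition expsum N (j : 'I_N) (w : seq (letter N)) : int :=
  \sum_(a <- w | a.1 == j) (if a.2 then (-1)%R else 1%R).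

(* s acts trivially on H_1(F_N; Z/3Z) *)
Definition IA3 N (s : endo N) : Prop :=
  forall i j : 'I_N, (expsum j (s i) == (i == j)%:Z %[mod 3])%Z.

(* Main.v *)
(** Let [A] be
    the ring of power series over the rationals in noncommuting variables [X_i],
    filtered by order, and embed [F_N] in [A] by the Magnus map [x_i |-> 1 + X_i];
    endomorphisms of [F_N] act on [A] by substitution.  On each graded piece of
    [A], the action of an element of IA_N(Z/3) is integral and congruent to 1
    modulo 3.  For commuting endomorphisms [T], [U] of a lattice that are 1
    modulo 3, the sum of the [T^i U^(k-1-i)] is injective (no nontrivial root of
    unity is 1 modulo 3).  If [phi^k = c_g psi^k], this is used twice, degree by
    degree: with [U = 1] it solves [h psi(h) ... psi^(k-1)(h) = g] for a power
    series [h] with constant term 1, and then it gives [phi(f) h = h psi(f)] for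
    all [f].  Finally [h] lies in [F_N] up to the Magnus map: it conjugates
    a generator to an element of [F_N], a comparison of cyclic coefficients shows
    that this element is a conjugate of the generator in [F_N], so [h] may be
    assumed to commute with [X_1]; then [h] is a power series in [X_1], and
    [h (1 + X_2) h^-1] being in [F_N] forces [h] to be a power of [x_1]. *)
Require Import Defs.
From mathcomp Require Import all_boot all_order all_algebra.
From HB Require Import structures.
From mathcomp Require Import boolp ssrAC.
Set Implicit Arguments. Unset Strict Implicit. Unset Printing Implicit Defensive.
Import Order.TTheory GRing.Theory Num.Theory.

(** * Roots of operators congruent to 1 modulo 3 *)

Section PowerEquation.
Local Open Scope ring_scope.
(** [V] will be a graded piece over the rationals and [L] its integral lattice. [L] is only a
    predicate, so that [T] and [U] remain additive maps on all of [V]. *)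
Variables (V : zmodType) (L : V -> Prop).
Hypothesis torsion_free : forall n (v : V), v *+ n.+1 = 0 -> v = 0.
Hypotheses (L0 : L 0) (LB : forall u v, L u -> L v -> L (u - v)).
Hypothesis L3 : forall v, (forall n, exists2 u, L u & v = u *+ 3 ^ n) -> v = 0.
Implicit Types (T U : {additive V -> V}) (u v w : V).

Let LN u : L u -> L (- u). Proof. by move=> Lu; rewrite -sub0r; apply: LB. Qed.
Let LD u v : L u -> L v -> L (u + v).
Proof. by move=> Lu Lv; rewrite -[v]opprK; apply: LB => //; apply: LN. Qed.
Let LMn u n : L u -> L (u *+ n).
Proof. by move=> Lu; elim: n => [|n IH]; rewrite ?mulr0n ?mulrS //; apply: LD. Qed.

Definition one_mod3 (T : V -> V) :=
  forall v, L v -> exists2 s, L s & T v = v + s *+ 3.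

Lemma one_mod3_stable (T : V -> V) v : one_mod3 T -> L v -> L (T v).
Proof. by move=> T1 Lv; have [s Ls ->] := T1 v Lv; apply: LD => //; apply: LMn. Qed.

Lemma one_mod3_comp (T U : V -> V) : one_mod3 T -> one_mod3 U -> one_mod3 (T \o U).
Proof.
move=> T1 U1 v Lv /=; have [s Ls Es] := T1 _ (one_mod3_stable U1 Lv).
have [r Lr Er] := U1 v Lv.
by exists (r + s); [exact: LD | rewrite Es Er mulrnDl -addrA].
Qed.

Lemma one_mod3_iter (T : V -> V) k : one_mod3 T -> one_mod3 (iter k T).
Proof.
move=> T1; elim: k => [|k IH]; last exact: (one_mod3_comp T1 IH).
by move=> v Lv; exists 0; rewrite ?mul0rn ?addr0.
Qed.

(** Infinite descent: iterating the division makes [v] divisible by every power of 3 inside [L]. In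
    the uses below, [P] is the part of a kernel that lies in [L]. *)
Lemma descent3 (P : V -> Prop) v : (forall u, P u -> L u) ->
  (forall u, P u -> exists2 u', P u' & u = u' *+ 3) -> P v -> v = 0.
Proof.
move=> PL step Pv; apply: L3 => n.
suff [u Pu ->] : exists2 u, P u & v = u *+ 3 ^ n by exists u => //; apply: PL.
elim: n => [|n [u Pu ->]]; first by exists v.
by have [u' Pu' ->] := step u Pu; exists u' => //; rewrite -mulrnA expnS.
Qed.

(** If [T u = u + 3s = 0] then [u = 3(-s)], and [-s] is again in the kernel because there is no
    torsion; descent applies. *)
Lemma one_mod3_inj T v : one_mod3 T -> L v -> T v = 0 -> v = 0.
Proof.
move=> T1 Lv Tv; apply: (@descent3 (fun u => L u /\ T u = 0)) => // [u [] //|u [Lu Tu]].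
have [s Ls Es] := T1 u Lu; exists (- s); last first.
  by apply/eqP; rewrite mulNrn -addr_eq0 -Es Tu.
split; first exact: LN.
apply: (@torsion_free 2); rewrite -raddfMn mulNrn.
by have -> : - (s *+ 3) = u by apply/eqP; rewrite eq_sym -addr_eq0 -Es Tu.
Qed.

(* The sum of [U^(k-1-i) T^i] over [i < k] when [T] and [U] commute. *)
Fixpoint power_sum (T U : V -> V) k v : V :=
  if k is k'.+1 then U (power_sum T U k' v) + iter k' T v else 0.

Lemma iter_additive T k : {morph iter k T : u v / u - v}.
Proof. by move=> u v; elim: k => //= k ->; rewrite raddfB. Qed.

Lemma power_sumMn T U k v n : power_sum T U k (v *+ n) = power_sum T U k v *+ n.
Proof.
have iterMn j : iter j T (v *+ n) = iter j T v *+ n.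
  by elim: j => //= j ->; rewrite raddfMn.
by elim: k => [|k IH] /=; rewrite ?mul0rn // IH raddfMn iterMn mulrnDl.
Qed.

Lemma power_sum_mod3 T U k v : one_mod3 T -> one_mod3 U -> L v ->
  exists2 s, L s & power_sum T U k v = v *+ k + s *+ 3.
Proof.
move=> T1 U1 Lv; elim: k => [|k [s Ls Es]] /=; first by exists 0; rewrite ?mul0rn ?addr0.
have LS : L (power_sum T U k v) by rewrite Es; apply: LD; apply: LMn.
have [r Lr ->] := U1 _ LS; have [t Lt ->] := one_mod3_iter k T1 Lv.
exists (s + r + t); first by do 2!apply: LD => //.
rewrite Es [v *+ k.+1]mulrSr !mulrnDl; move: (v *+ k) (s *+ 3) (r *+ 3) (t *+ 3) => a b c d.
by rewrite (AC (3*2) ((1*4)*(2*3*5))).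
Qed.

(** For [k = 3] the congruence modulo 3 says nothing, so one more order is needed. Writing
    [U = 1 + 3A] and [T = 1 + 3B], the sum [U^2 + UT + T^2] is [3 + 9(A + B + A^2 + AB + B^2)],
    three times an operator that is 1 modulo 3. *)
Lemma power_sum3 T U v : one_mod3 T -> one_mod3 U -> L v ->
  exists2 s, L s & power_sum T U 3 v = (v + s *+ 3) *+ 3.
Proof.
move=> T1 U1 Lv; rewrite /= raddf0 add0r.
have [a La Ea] := U1 v Lv; have [b Lb Eb] := T1 v Lv.
have [a' La' Ea'] := U1 a La; have [b' Lb' Eb'] := U1 b Lb.
have [c Lc Ec] := T1 b Lb.
exists (a + b + a' + b' + c); first by do 4!apply: LD => //.
have H3 (W : {additive V -> V}) x y : W (x + y *+ 3) = W x + W y *+ 3.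
  by rewrite raddfD raddfMn.
rewrite (raddfD U) Ea Eb !H3 Ea Eb Ea' Eb' Ec.
(* [3] is abstracted to [q], as [_ *+ 3] would unify with a sum. *)
move: {-2}3%N (erefl 3%N) => q q3.
have E (x : V) : x *+ q = x + x + x by rewrite q3 !mulrSr mulr0n add0r.
rewrite !mulrnDl [v *+ q]E [a *+ q *+ q]E [b *+ q *+ q]E.
move: (a *+ q) (b *+ q) (a' *+ q *+ q) (b' *+ q *+ q) (c *+ q *+ q) => A B A' B' C.
by rewrite !addrA [LHS](AC 12%AC (1*5*9*2*3*6*7*10*11*4*8*12)).
Qed.

(** Common end of the two injectivity proofs below; the factor [m.+1], cancelled by
    torsion-freeness, is 1 when 3 does not divide [k] and 3 when [k = 3]. *)
Lemma power_sum_kernel T U k v m : one_mod3 T -> one_mod3 U -> L v ->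
  power_sum T U k v = 0 ->
  (forall u, L u -> power_sum T U k u = 0 -> exists2 u', L u' & u *+ m.+1 = u' *+ 3 *+ m.+1) ->
  v = 0.
Proof.
move=> T1 U1 Lv Fv H.
apply: (@descent3 (fun u => L u /\ power_sum T U k u = 0)) => // [u [] //|u [Lu Fu]].
have [u' Lu' E] := H u Lu Fu.
have Eu : u = u' *+ 3.
  apply/eqP; rewrite -subr_eq0; apply/eqP/(@torsion_free m).
  by rewrite mulrnBl E subrr.
exists u' => //; split=> //; apply: (@torsion_free 2).
by rewrite -power_sumMn -Eu.
Qed.

Lemma power_sum_coprime_inj T U k v : one_mod3 T -> one_mod3 U -> L v ->
  ~~ (3 %| k)%N -> power_sum T U k v = 0 -> v = 0.
Proof.
move=> T1 U1 Lv k3 Fv.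
apply: (@power_sum_kernel _ _ k v 0%N T1 U1 Lv Fv) => u Lu Fu.
have [s Ls] := power_sum_mod3 k T1 U1 Lu; rewrite Fu => Es.
have kE : u *+ k = - s *+ 3 by apply/eqP; rewrite mulNrn -addr_eq0 -Es.
have /eqP cop : coprime k 3 by rewrite coprime_sym prime_coprime.
have k0 : (0 < k)%N by case: k k3 {Fv Fu Es kE cop}.
(* Bezout gives [a * k = b * 3 + 1]; with [k u = -3s] this yields [u = 3(-a s - b u)]. *)
have [a b Eab _] := egcdnP 3 k0; rewrite cop in Eab.
exists (- s *+ a - u *+ b); first by apply: LB; apply: LMn => //; apply: LN.
rewrite !mulr1n mulrnBl -mulrnA mulnC mulrnA -kE -!mulrnA [(k * a)%N]mulnC Eab.
by rewrite addn1 mulrSr addrC addKr.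
Qed.

Lemma power_sum3_inj T U v : one_mod3 T -> one_mod3 U -> L v ->
  power_sum T U 3 v = 0 -> v = 0.
Proof.
move=> T1 U1 Lv Fv.
apply: (@power_sum_kernel _ _ 3 v 2 T1 U1 Lv Fv) => u Lu.
have [s Ls ->] := power_sum3 T1 U1 Lu => Es.
exists (- s); first exact: LN.
by apply/eqP; rewrite -subr_eq0 -mulrnBl mulNrn opprK Es.
Qed.

Section Commuting.
Variables T U : {additive V -> V}.
Hypothesis TU : forall v, T (U v) = U (T v).

Lemma iter_comm k v : iter k T (U v) = U (iter k T v).
Proof. by elim: k => //= k ->; rewrite TU. Qed.

(** The factorization of [T^k - U^k]. Here the difference is applied last, which exploits a vector
    in the kernel of the sum; in [power_sum_subr] it is applied first, which produces such a
    vector. *)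
Lemma power_sum_subl k v :
  T (power_sum T U k v) - U (power_sum T U k v) = iter k T v - iter k U v.
Proof.
elim: k => [|k IH] /=; first by rewrite (raddf0 T) (raddf0 U) !subrr.
rewrite (raddfD T) (raddfD U) TU opprD addrACA -raddfB IH raddfB.
by rewrite addrC addrA subrK.
Qed.

Lemma power_sum_subr k v : power_sum T U k (T v - U v) = iter k T v - iter k U v.
Proof.
elim: k => [|k IH] /=; first by rewrite subrr.
rewrite IH raddfB iter_additive -iterSr iter_comm /=.
by rewrite addrC addrA subrK.
Qed.
End Commuting.
End PowerEquation.

(** * Uniqueness of roots and injectivity of the power sum, for every exponent *)

Section RootUniqueness.
Local Open Scope ring_scope.
Variables (V : zmodType) (L : V -> Prop).
Hypothesis torsion_free : forall n (v : V), v *+ n.+1 = 0 -> v = 0.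
Hypotheses (L0 : L 0) (LB : forall u v, L u -> L v -> L (u - v)).
Hypothesis L3 : forall v, (forall n, exists2 u, L u & v = u *+ 3 ^ n) -> v = 0.

(** Factors 3 are stripped from [k] one at a time: for [k = 3m] the induction hypothesis, applied to
    [T^3] and [U^3], gives [T^3 v = U^3 v], and the case of exponent 3 concludes. Once 3 no longer
    divides [k], the coprime case applies. *)
Lemma iter_eq_one_mod3 k (T U : {additive V -> V}) v : (forall v, T (U v) = U (T v)) ->
  one_mod3 L T -> one_mod3 L U -> L v -> (0 < k)%N ->
  iter k T v = iter k U v -> T v = U v.
Proof.
elim/ltn_ind: k T U => k IH T U TU T1 U1 Lv k0 E.
apply/eqP; rewrite -subr_eq0; apply/eqP.
have Lw : L (T v - U v) by apply: LB; apply: one_mod3_stable.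
have [/dvdnP[m km]|k3] := boolP (3 %| k)%N; last first.
  apply: (power_sum_coprime_inj _ L0 LB L3 T1 U1 Lw k3) => //.
  by rewrite power_sum_subr // E subrr.
apply: (power_sum3_inj _ L0 LB L3 T1 U1 Lw) => //.
rewrite power_sum_subr //; apply/eqP; rewrite subr_eq0; apply/eqP.
have m0 : (0 < m)%N by case: m km k0 => // ->.
have mk : (m < k)%N by rewrite km ltn_Pmulr.
apply: (IH m mk (T \o T \o T : {additive V -> V}) (U \o U \o U : {additive V -> V})) => //.
- by move=> u /=; rewrite !TU.
- by do 2?[apply: one_mod3_comp => //].
- by do 2?[apply: one_mod3_comp => //].
have it3 (W : V -> V) : iter m (W \o W \o W) v = iter k W v.
  by rewrite km iterM; apply: eq_iter.
by rewrite !it3.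
Qed.

(** A vector in the kernel satisfies [T^k v = U^k v], hence [T v = U v]. The sum then collapses to
    [k T^(k-1) v], and [T] is injective on [L]. *)
Lemma power_sum_inj k (T U : {additive V -> V}) v : (forall v, T (U v) = U (T v)) ->
  one_mod3 L T -> one_mod3 L U -> L v -> (0 < k)%N -> power_sum T U k v = 0 -> v = 0.
Proof.
move=> TU T1 U1 Lv k0 Fv.
have E : iter k T v = iter k U v.
  by apply/eqP; rewrite -subr_eq0 -power_sum_subl // Fv (raddf0 T) (raddf0 U) subrr.
have {}E := iter_eq_one_mod3 TU T1 U1 Lv k0 E.
have Fk j : power_sum T U j v = iter j.-1 T v *+ j.
  elim: j => // j IH /=; rewrite IH raddfMn mulrSr; congr (_ + _).
  by case: j {IH} => [|j]; rewrite ?mulr0n //= -iter_comm // -E -iterSr.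
have {}Fv : iter k.-1 T v = 0.
  by apply: (@torsion_free k.-1); rewrite prednK // -Fk.
elim: k.-1 Fv => //= j IH Tj; apply: IH.
by apply: (one_mod3_inj torsion_free L0 LB L3 T1) => //; apply: one_mod3_stable => //;
  apply: one_mod3_iter.
Qed.
End RootUniqueness.

(** * Noncommutative power series *)

Definition pser (I : Type) : Type := seq I -> rat.

HB.instance Definition _ (I : Type) := gen_eqMixin (pser I).
HB.instance Definition _ (I : Type) := gen_choiceMixin (pser I).

Section PowerSeriesRing.
Local Open Scope ring_scope.
Variable I : Type.
Implicit Types (f g h : pser I) (w u : seq I) (i : I).

Definition dl i f : pser I := fun w => f (i :: w).
Definition pconst (c : rat) : pser I := fun w => if w is [::] then c else 0.
Definition padd f g : pser I := fun w => f w + g w.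
Definition popp f : pser I := fun w => - f w.
(** The Cauchy product, written as a recursion on the word so that the ring axioms follow by
    structural induction; [pmulE] recovers the sum over all splittings of [w]. *)
Fixpoint pmul_rec f g w {struct w} : rat :=
  if w is i :: w' then f [::] * g w + pmul_rec (dl i f) g w' else f [::] * g [::].
Definition pmul f g : pser I := pmul_rec f g.

Fact paddA : associative padd.
Proof. by move=> f g h; apply/funext => w; rewrite /padd addrA. Qed.
Fact paddC : commutative padd.
Proof. by move=> f g; apply/funext => w; rewrite /padd addrC. Qed.
Fact padd0 : left_id (pconst 0) padd.
Proof. by move=> f; apply/funext => -[|i w]; rewrite /padd add0r. Qed.
Fact paddN : left_inverse (pconst 0) popp padd.
Proof. by move=> f; apply/funext => -[|i w]; rewrite /padd /popp addNr. Qed.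

HB.instance Definition _ := GRing.isZmodule.Build (pser I) paddA paddC padd0 paddN.

Lemma pserD f g w : (f + g) w = f w + g w. Proof. by []. Qed.
Lemma pserN f w : (- f) w = - f w. Proof. by []. Qed.
Lemma pserB f g w : (f - g) w = f w - g w. Proof. by []. Qed.
Lemma pser0 w : (0 : pser I) w = 0. Proof. by case: w. Qed.
Lemma pser_sum (J : Type) (r : seq J) (P : pred J) (F : J -> pser I) w :
  (\sum_(j <- r | P j) F j) w = \sum_(j <- r | P j) F j w.
Proof.
by elim/big_rec2: _ => [|j x y _ <-]; rewrite ?pser0 ?pserD.
Qed.

Lemma dlD i f g : dl i (f + g) = dl i f + dl i g. Proof. by []. Qed.

Fact pmulDl : left_distributive pmul +%R.
Proof.
move=> f g h; apply/funext => w; rewrite pserD /pmul.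
elim: w f g => [|i w IH] f g /=; first by rewrite pserD mulrDl.
by rewrite dlD IH pserD mulrDl addrACA.
Qed.
Fact pmulDr : right_distributive pmul +%R.
Proof.
move=> f g h; apply/funext => w; rewrite pserD /pmul.
elim: w f => [|i w IH] f /=; first by rewrite pserD mulrDr.
by rewrite IH pserD mulrDr addrACA.
Qed.
Fact pmul_constl c f w : pmul (pconst c) f w = c * f w.
Proof.
rewrite /pmul; case: w => [|i w] //=.
suff -> : pmul_rec (dl i (pconst c)) f w = 0 by rewrite addr0.
have -> : dl i (pconst c) = pconst 0 by apply/funext=> -[].
have Z : forall v, pmul_rec (pconst 0) f v = 0.
  elim=> [|j v IH] /=; first by rewrite mul0r.
  have -> : dl j (pconst 0) = pconst 0 by apply/funext=> -[].
  by rewrite mul0r add0r.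
exact: Z.
Qed.
Fact pmul_constr c f w : pmul f (pconst c) w = c * f w.
Proof.
by rewrite /pmul; elim: w f => [|i w IH] f /=; rewrite ?IH ?mulr0 ?add0r // mulrC.
Qed.
Fact pmulA : associative pmul.
Proof.
move=> f g h; apply/funext => w; rewrite /pmul.
elim: w f g h => [|i w IH] f g h /=; first by rewrite mulrA.
have -> : dl i (pmul_rec f g : pser I) = pmul (pconst (f [::])) (dl i g) + pmul (dl i f) g.
  by apply/funext=> v; rewrite pserD pmul_constl.
rewrite -!/(pmul _ _ _) pmulDl pserD mulrDr -!addrA mulrA; congr (_ + _).
rewrite /pmul IH; congr (_ + _).
have := IH (pconst (f [::])) (dl i g) h; rewrite -!/(pmul _ _ _) => <-.
by rewrite pmul_constl.
Qed.
Fact pmul1l : left_id (pconst 1) pmul.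
Proof. by move=> f; apply/funext => w; rewrite pmul_constl mul1r. Qed.
Fact pmul1r : right_id (pconst 1) pmul.
Proof. by move=> f; apply/funext => w; rewrite pmul_constr mul1r. Qed.
Fact pone_neq0 : pconst 1 != 0 :> pser I.
Proof. by apply/eqP => /(congr1 (fun f => f [::])); rewrite pser0 => /eqP; rewrite oner_eq0. Qed.

HB.instance Definition _ :=
  GRing.Zmodule_isNzRing.Build (pser I) pmulA pmul1l pmul1r pmulDl pmulDr pone_neq0.

(** Units and inverses are chosen classically, which gives access to the general theory of unit
    rings; [invr_geom] later identifies the inverse with a geometric series. *)
Definition punit : {pred pser I} := fun f => `[< exists g, g * f = 1 /\ f * g = 1 >].
Definition pinv f : pser I :=
  if pselect (exists g, g * f = 1 /\ f * g = 1) is left H then projT1 (cid H) else f.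

Fact pmulVr : {in punit, left_inverse 1 pinv *%R}.
Proof.
move=> f /asboolP uf; rewrite /pinv; case: pselect => // H.
by case: (projT2 (cid H)).
Qed.
Fact pmulrV : {in punit, right_inverse 1 pinv *%R}.
Proof.
move=> f /asboolP uf; rewrite /pinv; case: pselect => // H.
by case: (projT2 (cid H)).
Qed.
Fact punitP f g : g * f = 1 /\ f * g = 1 -> punit f.
Proof. by move=> H; apply/asboolP; exists g. Qed.
Fact pinv_out : {in [predC punit], pinv =1 id}.
Proof.
move=> f /asboolP uf; rewrite /pinv; case: pselect => // H; case: uf.
Qed.
HB.instance Definition _ :=
  GRing.NzRing_hasMulInverse.Build (pser I) pmulVr pmulrV punitP pinv_out.

Lemma pmul_nil f g : (f * g) [::] = f [::] * g [::]. Proof. by []. Qed.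
Lemma pmul_cons f g i w : (f * g) (i :: w) = f [::] * g (i :: w) + (dl i f * g) w.
Proof. by []. Qed.
Lemma pone_nil : (1 : pser I) [::] = 1. Proof. by []. Qed.
Lemma pone_cons i w : (1 : pser I) (i :: w) = 0. Proof. by []. Qed.
Lemma pconstl c f w : (pconst c * f) w = c * f w. Proof. exact: pmul_constl. Qed.
Lemma pconstC c f : f * pconst c = pconst c * f.
Proof. by apply/funext=> w; rewrite pconstl [LHS]pmul_constr. Qed.

Lemma pmulE f g w :
  (f * g) w = \sum_(s < (size w).+1) f (take s w) * g (drop s w).
Proof.
elim: w f => [|i w IH] f; first by rewrite big_ord1.
by rewrite pmul_cons IH [RHS]big_ord_recl take0 drop0; congr (_ + _); apply: eq_bigr => s _.
Qed.

(** The filtration by order: [ord_ge n (f - g)] serves as congruence in degrees below [n], and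
    [ord_ge_eq0] turns congruence for all [n] into equality. *)
Definition ord_ge n f := forall w, (size w < n)%N -> f w = 0.

Lemma ord_ge0 f : ord_ge 0 f. Proof. by []. Qed.
Lemma ord_ge_zero n : ord_ge n 0. Proof. by move=> w _; rewrite pser0. Qed.
Lemma ord_geD n f g : ord_ge n f -> ord_ge n g -> ord_ge n (f + g).
Proof. by move=> F G w Hw; rewrite pserD F // G // addr0. Qed.
Lemma ord_geN n f : ord_ge n f -> ord_ge n (- f).
Proof. by move=> F w Hw; rewrite pserN F // oppr0. Qed.
Lemma ord_ge_sum n (J : Type) (r : seq J) (P : pred J) (F : J -> pser I) :
  (forall j, P j -> ord_ge n (F j)) -> ord_ge n (\sum_(j <- r | P j) F j).
Proof. by move=> H; elim/big_ind: _ => //; [exact: ord_ge_zero | exact: ord_geD]. Qed.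
Lemma ord_ge_le m n f : (m <= n)%N -> ord_ge n f -> ord_ge m f.
Proof. by move=> mn F w Hw; apply: F; apply: leq_trans mn. Qed.
Lemma ord_geM m n f g : ord_ge m f -> ord_ge n g -> ord_ge (m + n) (f * g).
Proof.
move=> F G w Hw; rewrite pmulE big1 // => s _.
have ls : (s <= size w)%N by rewrite -ltnS.
have [Hs|Hs] := ltnP s m; first by rewrite F ?mul0r // size_takel.
rewrite G ?mulr0 // size_drop ltn_subLR //.
by apply: leq_trans Hw _; rewrite leq_add2r.
Qed.
Lemma ord_geMl n f g : ord_ge n g -> ord_ge n (f * g).
Proof. by move=> G; have := ord_geM (ord_ge0 f) G. Qed.
Lemma ord_geMr n f g : ord_ge n f -> ord_ge n (f * g).
Proof. by move=> F; have := ord_geM F (ord_ge0 g); rewrite addn0. Qed.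
Lemma ord_ge1 f : f [::] = 0 -> ord_ge 1 f.
Proof. by move=> H [|]. Qed.
Lemma ord_geX n f : f [::] = 0 -> ord_ge n (f ^+ n).
Proof.
move=> H; elim: n => [|n IH]; first exact: ord_ge0.
by rewrite exprS -add1n; apply: ord_geM => //; apply: ord_ge1.
Qed.
Lemma ord_ge_eq0 f : (forall n, ord_ge n f) -> f = 0.
Proof. by move=> H; apply/funext=> w; rewrite (H (size w).+1) // pser0. Qed.
Lemma ord_ge_sym n f g : ord_ge n (f - g) -> ord_ge n (g - f).
Proof. by move/ord_geN; rewrite opprB. Qed.
Lemma ord_ge_trans n g f h : ord_ge n (f - g) -> ord_ge n (g - h) -> ord_ge n (f - h).
Proof. by move=> A B; rewrite -(subrK g f) -addrA; apply: ord_geD. Qed.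
Lemma ord_ge_sub_eq n f g : ord_ge n (f - g) -> forall w, (size w < n)%N -> f w = g w.
Proof. by move=> H w /H /eqP; rewrite pserB subr_eq0 => /eqP. Qed.

(** When [f] has constant term 0, the powers beyond [size w] do not reach [w], so this truncation is
    the full geometric series. *)
Definition geom f : pser I := fun w => (\sum_(j < (size w).+1) f ^+ j) w.

Lemma geom_approx f n : f [::] = 0 -> ord_ge n (geom f - \sum_(j < n) f ^+ j).
Proof.
move=> f0 w Hw; apply/eqP; rewrite pserB subr_eq0 /geom !pser_sum; apply/eqP.
rewrite (big_ord_widen n (fun j => (f ^+ j) w)) // big_mkcond /=.
apply: eq_bigr => j _; case: ltnP => // Hj.
by rewrite (ord_geX f0).
Qed.

Lemma geom_unit f : f [::] = 0 -> geom f * (1 - f) = 1 /\ (1 - f) * geom f = 1.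
Proof.
move=> f0.
have E n : (1 - f) * (\sum_(j < n) f ^+ j) = 1 - f ^+ n.
  by rewrite -[1 - f]opprB mulNr -subrX1 opprB.
have C n : (1 - f) * (\sum_(j < n) f ^+ j) = (\sum_(j < n) f ^+ j) * (1 - f).
  apply: commr_sum => j _; apply: commrX; apply: commr_sym.
  by apply: commrB => //; apply: commr1.
have S n : ord_ge n ((1 - f ^+ n) - 1).
  by rewrite addrAC subrr add0r; apply/ord_geN/ord_geX.
split; apply/eqP; rewrite -subr_eq0; apply/eqP/ord_ge_eq0 => n.
  apply: ord_ge_trans (S n); rewrite -E C -mulrBl.
  exact/ord_geMr/geom_approx.
apply: ord_ge_trans (S n); rewrite -E -mulrBr.
exact/ord_geMl/geom_approx.
Qed.

Lemma pser_unit f : f [::] = 1 -> f \is a GRing.unit.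
Proof.
move=> f1; have H : (1 - f) [::] = 0 by rewrite pserB f1 subrr.
by have := geom_unit H; rewrite subKr; apply: punitP.
Qed.

Definition pint f := forall w, f w \is a Num.int.

End PowerSeriesRing.

Definition div3 (x : rat) : bool := (x / 3%:R)%R \is a Num.int.

(** * Substitution *)

Section Substitution.
Local Open Scope ring_scope.
Variable I : finType.
Implicit Types (f g h : pser I) (w u : seq I) (i j : I).

Definition pX i : pser I := fun w => (w == [:: i])%:R.

Lemma dl_pX i j : dl j (pX i) = pconst (i == j)%:R.
Proof.
apply/funext=> -[|l w]; rewrite /dl /pX /= eqseq_cons ?andbT ?andbF //.
by rewrite eq_sym.
Qed.

Lemma pXM_nil i f : (pX i * f) [::] = 0.
Proof. by rewrite pmul_nil mul0r. Qed.

Lemma pXM_cons i f j w : (pX i * f) (j :: w) = (i == j)%:R * f w.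
Proof. by rewrite pmul_cons mul0r add0r dl_pX pconstl. Qed.

Lemma pser_expand f : f = pconst (f [::]) + \sum_i pX i * dl i f.
Proof.
apply/funext=> -[|j w]; rewrite pserD pser_sum.
  by rewrite big1 ?addr0 // => i _; rewrite pXM_nil.
rewrite add0r (bigD1 j) //= pXM_cons eqxx mul1r big1 ?addr0 // => i ij.
by rewrite pXM_cons (negPf ij) mul0r.
Qed.

Lemma ord_ge_dl n f i : ord_ge n.+1 f -> ord_ge n (dl i f).
Proof. by move=> F w Hw; apply: F. Qed.

Lemma dlM i f g : dl i (f * g) = pconst (f [::]) * dl i g + dl i f * g.
Proof. by apply/funext=> w; rewrite pserD pconstl. Qed.

Lemma pmul_lead n f g w : ord_ge n g -> size w = n -> (f * g) w = f [::] * g w.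
Proof.
move=> G sw; rewrite pmulE big_ord_recl take0 drop0 big1 ?addr0 // => s _.
rewrite G ?mulr0 // size_drop -sw ltn_subrL /=.
exact: leq_ltn_trans (leq0n _) (ltn_ord s).
Qed.

Section Subst.
Variable y : I -> pser I.

(** The counter [n] bounds the recursion. As the [y i] have no constant term, coefficients of words
    shorter than [n] are final after [n] rounds, which is why [subst] takes [(size w).+1] rounds. *)
Fixpoint subst_rec n f : pser I :=
  if n is n'.+1 then pconst (f [::]) + \sum_i y i * subst_rec n' (dl i f) else 0.

Definition subst f : pser I := fun w => subst_rec (size w).+1 f w.

Hypothesis y0 : forall i, y i [::] = 0.

Lemma subst_rec_stable n m f : (n <= m)%N ->
  ord_ge n (subst_rec m f - subst_rec n f).
Proof.
elim: n m f => [|n IH] [|m] f //= nm.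
rewrite opprD addrACA subrr add0r -sumrB; apply: ord_ge_sum => i _.
rewrite -mulrBr -add1n; apply: ord_geM; last exact: IH.
exact/ord_ge1/y0.
Qed.

Lemma subst_approx n f : ord_ge n (subst f - subst_rec n f).
Proof.
move=> w Hw; rewrite pserB /subst; apply/eqP; rewrite subr_eq0 eq_sym; apply/eqP.
by rewrite (ord_ge_sub_eq (@subst_rec_stable (size w).+1 n f Hw)).
Qed.

Lemma substE f : subst f = pconst (f [::]) + \sum_i y i * subst (dl i f).
Proof.
apply/eqP; rewrite -subr_eq0; apply/eqP/ord_ge_eq0 => n.
apply: (ord_ge_trans (@subst_approx n f)).
case: n => [|n]; first exact: ord_ge0.
rewrite /= opprD addrACA subrr add0r -sumrB; apply: ord_ge_sum => i _.
rewrite -mulrBr -add1n; apply: ord_geM; last exact/ord_ge_sym/subst_approx.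
exact/ord_ge1/y0.
Qed.

Lemma subst_nil f : subst f [::] = f [::].
Proof.
rewrite substE pserD pser_sum big1 ?addr0 // => i _.
by rewrite pmul_nil y0 mul0r.
Qed.

Lemma subst_recB n : {morph subst_rec n : f g / f - g}.
Proof.
elim: n => [|n IH] f g /=; first by rewrite subr0.
have -> : pconst ((f - g) [::]) = pconst (f [::]) - pconst (g [::]) :> pser I.
  by apply/funext=> -[|? ?]; rewrite !pserB //= subr0.
rewrite opprD addrACA; congr (_ + _); rewrite -sumrB; apply: eq_bigr => i _.
by rewrite -mulrBr -IH.
Qed.

Lemma substB : {morph subst : f g / f - g}.
Proof. by move=> f g; apply/funext=> w; rewrite pserB /subst subst_recB. Qed.

Lemma subst0 : subst 0 = 0. Proof. by have := substB 0 0; rewrite !subrr. Qed.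
Lemma substN f : subst (- f) = - subst f.
Proof. by rewrite -sub0r substB subst0 sub0r. Qed.
Lemma substD : {morph subst : f g / f + g}.
Proof. by move=> f g; rewrite -[g]opprK substB substN !opprK. Qed.

Lemma subst_const c : subst (pconst c) = pconst c.
Proof.
rewrite substE big1 ?addr0 // => i _.
have -> : dl i (pconst c) = 0 by apply/funext=> w; rewrite pser0.
by rewrite subst0 mulr0.
Qed.
Lemma subst1 : subst 1 = 1. Proof. exact: subst_const. Qed.

Lemma subst_pX i : subst (pX i) = y i.
Proof.
rewrite substE -[RHS]add0r; congr (_ + _).
rewrite (bigD1 i) //= dl_pX eqxx subst1 mulr1 big1 ?addr0 // => j ji.
rewrite dl_pX eq_sym (negPf ji) subst_const.
by apply/funext=> w; rewrite pconstC pconstl mul0r pser0.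
Qed.

Lemma ord_ge_subst n f : ord_ge n f -> ord_ge n (subst f).
Proof.
elim: n f => [|n IH] f F; first exact: ord_ge0.
rewrite substE; apply: ord_geD.
  by rewrite F //; apply: ord_ge_zero.
apply: ord_ge_sum => i _; rewrite -add1n; apply: ord_geM; first exact/ord_ge1/y0.
exact/IH/ord_ge_dl.
Qed.

Lemma pconstM c d : pconst (c * d) = pconst c * pconst d :> pser I.
Proof. by apply/funext=> v; rewrite pconstl; case: v => //=; rewrite mulr0. Qed.

Lemma subst_recZ n c f : subst_rec n (pconst c * f) = pconst c * subst_rec n f.
Proof.
elim: n f => [|n IH] f /=; first by rewrite mulr0.
rewrite pconstl pconstM mulrDr; congr (_ + _).
rewrite mulr_sumr; apply: eq_bigr => i _.
have -> : dl i (pconst c * f) = pconst c * dl i f by apply/funext=> v; rewrite /dl !pconstl.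
by rewrite IH mulrA [in RHS]mulrA pconstC.
Qed.

Lemma substZ c f : subst (pconst c * f) = pconst c * subst f.
Proof. by apply/funext=> w; rewrite /subst subst_recZ !pconstl. Qed.

(** The failure of multiplicativity for [f] is the sum of the [y i] times the failures for the
    [dl i f]; each [y i] raises the order by one, so it vanishes in every degree. *)
Lemma substM : {morph subst : f g / f * g}.
Proof.
move=> f g; apply/eqP; rewrite -subr_eq0; apply/eqP/ord_ge_eq0 => n.
elim: n f g => [|n IH] f g; first exact: ord_ge0.
suff -> : subst (f * g) - subst f * subst g =
    \sum_i y i * (subst (dl i f * g) - subst (dl i f) * subst g).
  apply: ord_ge_sum => i _; rewrite -add1n; apply: ord_geM; last exact: IH.
  exact/ord_ge1/y0.
apply/eqP; rewrite subr_eq; apply/eqP.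
rewrite substE pmul_nil [subst f in RHS]substE mulrDl [X in pconst (f [::]) * X]substE.
rewrite mulrDr -!addrA [RHS]addrCA pconstM; congr (_ + _).
rewrite mulr_sumr mulr_suml -!big_split /=; apply: eq_bigr => i _.
rewrite dlM substD substZ mulrDr !mulrBr !mulrA pconstC.
by rewrite [RHS]addrC addrACA subrr addr0.
Qed.

Lemma subst_lead n f j w : ord_ge n.+1 f -> size w = n ->
  subst f (j :: w) = \sum_i y i [:: j] * subst (dl i f) w.
Proof.
move=> F sw; rewrite substE pserD add0r pser_sum; apply: eq_bigr => i _.
rewrite pmul_cons y0 mul0r add0r (pmul_lead _ _ sw) //.
exact/ord_ge_subst/ord_ge_dl.
Qed.

Hypothesis y_int : forall i, pint (y i).
Hypothesis y_mod3 : forall i j, div3 (y i [:: j] - (i == j)%:R).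

(** In degree [n] the substitution acts as the [n]-th tensor power of the linear part of [y], which
    is the identity modulo 3. The induction splits off one tensor factor. *)
Lemma subst_mod3 n f w : pint f -> ord_ge n f -> size w = n -> div3 (subst f w - f w).
Proof.
have D3 a b : div3 a -> div3 b -> div3 (a + b).
  by rewrite /div3 mulrDl; apply: rpredD.
have M3 a b : div3 a -> b \is a Num.int -> div3 (a * b).
  by rewrite /div3 mulrAC; apply: rpredM.
elim: n f w => [|n IH] f [|j w] //= fZ fn sw; first by rewrite subst_nil subrr /div3 mul0r rpred0.
case: sw => sw; rewrite (subst_lead _ fn sw).
have -> : f (j :: w) = \sum_i (i == j)%:R * dl i f w.
  by rewrite (bigD1 j) //= eqxx mul1r big1 ?addr0 // => i /negPf ->; rewrite mul0r.
rewrite -sumrB; apply: (big_ind div3) => [|//|i _]; first by rewrite /div3 mul0r rpred0.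
have Sz : div3 (subst (dl i f) w - dl i f w).
  by apply: IH => //; [move=> v; apply: fZ | apply: ord_ge_dl].
have dZ : dl i f w \is a Num.int by apply: fZ.
have -> : y i [:: j] * subst (dl i f) w - (i == j)%:R * dl i f w =
  (subst (dl i f) w - dl i f w) * y i [:: j] + (y i [:: j] - (i == j)%:R) * dl i f w.
  by rewrite !mulrBl [subst _ _ * _]mulrC [dl i f w * _]mulrC addrA subrK.
by apply: D3; apply: M3 => //; apply: y_int.
Qed.

End Subst.
End Substitution.

(** * The action on graded pieces *)

Section Lattice.
Local Open Scope ring_scope.
Variable X : finType.
Notation V := {ffun X -> rat^o}.
Implicit Types u v : V.

Definition int_ffun v := forall x, (v x : rat) \is a Num.int.

Lemma ffun_torsion_free n v : v *+ n.+1 = 0 -> v = 0.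
Proof.
move=> /ffunP H; apply/ffunP => x; have := H x; rewrite ffunMnE ffunE => /eqP.
by rewrite mulrn_eq0 /= => /eqP.
Qed.

Lemma int_ffun0 : int_ffun 0.
Proof. by move=> x; rewrite ffunE; apply: rpred0. Qed.

Lemma int_ffunB u v : int_ffun u -> int_ffun v -> int_ffun (u - v).
Proof. by move=> U W x; rewrite !ffunE; apply: rpredB; [apply: U | apply: W]. Qed.

(** A nonzero integer [z] is not a multiple of [3 ^ |z|], since [|z| < 3 ^ |z|]. *)
Lemma int_ffun_divisible v :
  (forall n, exists2 u, int_ffun u & v = u *+ 3 ^ n) -> v = 0.
Proof.
move=> H; apply/ffunP => x; rewrite ffunE; apply/eqP/negPn/negP => vx.
have [u0 u0Z v0] := H 0%N; rewrite expn0 mulr1n in v0.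
have /Num.Theory.intrP[z Ez] := u0Z x; rewrite -v0 in Ez.
have [u uZ vu] := H `|z|%N; have Eu := congr1 (fun f : V => f x) vu.
rewrite /= ffunMnE in Eu.
have ux : u x != 0 by apply: contraNneq vx => u0x; rewrite Eu u0x mul0rn.
have := Num.Theory.norm_intr_ge1 (uZ x) ux.
have : (`|v x| < (3 ^ `|z|)%:R :> rat).
  rewrite Ez -intr_norm -abszE -[(Posz _)%:~R]/(_%:R) ltr_nat; exact: ltn_expl.
rewrite Eu normrMn -[X in X < _]mulr_natr -[X in _ < X]mul1r ltr_pM2r ?ltr0n ?expn_gt0 //
  => lt1 ge1.
by have := le_lt_trans ge1 lt1; rewrite ltxx.
Qed.

Lemma clear_denominators v : exists n, int_ffun (v *+ n.+1).
Proof.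
pose d : nat := \prod_x `|denq (v x)|%N.
have d0 : (0 < d)%N.
  by apply: prodn_cond_gt0 => x _; rewrite absz_gt0 denq_neq0.
exists d.-1 => x; rewrite prednK // ffunMnE /d (bigD1 x) //= mulrnA.
apply: rpredMn; rewrite -mulr_natr.
suff -> : (v x : rat) * `|denq (v x)|%N%:R = (numq (v x))%:~R by apply: Num.Theory.intr_int.
rewrite [RHS]numqE; congr (_ * _).
by rewrite -[_%:R]/((Posz `|denq (v x)|%N)%:~R) abszE gtr0_norm.
Qed.

End Lattice.

Section Graded.
Local Open Scope ring_scope.
Variables (I J : finType) (m : nat).
Notation X := (J * m.-tuple I)%type.
Notation V := {ffun X -> rat^o}.
Implicit Types (u v : V) (D E : J -> pser I).

(* Families indexed by [J] are used with [J] a singleton for the norm equation,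
   and with [J] the set of variables for the uniqueness argument. *)
Definition embed v : J -> pser I :=
  fun j w => if insub w is Some t then v (j, t) else 0.

Definition leading D : V := [ffun x => D x.1 (val x.2)].

Lemma ord_ge_embed v j : ord_ge m (embed v j).
Proof.
by move=> w sw; rewrite /embed insubN // neq_ltn sw.
Qed.

Lemma embedE v j (t : m.-tuple I) : embed v j t = v (j, t).
Proof. by rewrite /embed valK. Qed.

Lemma leading_embed v : leading (embed v) = v.
Proof. by apply/ffunP=> -[j t]; rewrite ffunE embedE. Qed.

Lemma leading_eq D E :
  (forall j, ord_ge m.+1 (D j - E j)) -> leading D = leading E.
Proof.
move=> H; apply/ffunP=> -[j t]; rewrite !ffunE /=.
by apply: (ord_ge_sub_eq (H j)); rewrite size_tuple.
Qed.

Lemma leading_eqP D E :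
  (forall j, ord_ge m (D j)) -> (forall j, ord_ge m (E j)) ->
  leading D = leading E -> forall j, ord_ge m.+1 (D j - E j).
Proof.
move=> Dm Em /ffunP H j w; rewrite ltnS leq_eqVlt => /predU1P[sw|sw]; last first.
  by rewrite pserB Dm // Em // subrr.
have := H (j, Tuple (introT eqP sw)); rewrite !ffunE /= pserB => ->.
exact: subrr.
Qed.

Lemma embed_leading D : (forall j, ord_ge m (D j)) ->
  forall j, ord_ge m.+1 (D j - embed (leading D) j).
Proof.
move=> Dm; apply: leading_eqP => //; first exact: ord_ge_embed.
by rewrite leading_embed.
Qed.

Lemma embed_linear a u v j : embed (a *: u + v) j = pconst a * embed u j + embed v j.
Proof.
apply/funext=> w; rewrite pserD pconstl /embed; case: insubP => [t _ _|_].
  by rewrite !ffunE.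
by rewrite mulr0 addr0.
Qed.

Section Action.
Variable y : I -> pser I.
Hypothesis y0 : forall i, y i [::] = 0.

Definition gr_subst v : V := leading (fun j => subst y (embed v j)).

Fact gr_subst_linear : linear gr_subst.
Proof.
move=> a u v; apply/ffunP=> -[j t]; rewrite !ffunE /= embed_linear.
by rewrite substD // substZ // pserD pconstl.
Qed.
HB.instance Definition _ := GRing.isLinear.Build rat V V *:%R gr_subst gr_subst_linear.

(** The induced map does not depend on the lift: [D] differs from its homogeneous part of degree [m]
    by terms of higher order, and substitution preserves order. *)
Lemma leading_subst D : (forall j, ord_ge m (D j)) ->
  leading (fun j => subst y (D j)) = gr_subst (leading D).
Proof.
move=> Dm; apply: leading_eq => j; rewrite -substB //.
exact/ord_ge_subst/embed_leading.
Qed.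

Lemma leading_iter_subst D k : (forall j, ord_ge m (D j)) ->
  leading (fun j => iter k (subst y) (D j)) = iter k gr_subst (leading D).
Proof.
move=> Dm; elim: k => //= k <-; rewrite leading_subst // => j.
by elim: k => //= k IH; apply: ord_ge_subst.
Qed.

Hypothesis y_int : forall i, pint (y i).
Hypothesis y_mod3 : forall i j, div3 (y i [:: j] - (i == j)%:R).

Lemma gr_subst_one_mod3 : one_mod3 (@int_ffun X) gr_subst.
Proof.
move=> v vZ; exists (3%:R^-1 *: (gr_subst v - v)).
  move=> -[j t]; rewrite !ffunE /=.
  have := @subst_mod3 _ y y0 y_int y_mod3 m (embed v j) t.
  rewrite /div3 mulrC embedE; apply.
  - by move=> w; rewrite /embed; case: insubP => // *; apply: rpred0.
  - exact: ord_ge_embed.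
  - exact: size_tuple.
by rewrite -scaler_nat scalerA mulfV // scale1r addrC subrK.
Qed.
End Action.

Section Mixing.
Variable M : J -> J -> rat.

(** The matrix [M] acting on the family index, tensored with the identity on words. It commutes with
    [gr_subst], which acts on the word factor only. *)
Definition mix v : V := [ffun x => \sum_l M x.1 l * v (l, x.2)].

Fact mix_linear : linear mix.
Proof.
move=> a u v; apply/ffunP=> -[j t]; rewrite !ffunE /= scaler_sumr -big_split /=.
by apply: eq_bigr => l _; rewrite !ffunE mulrDr; congr (_ + _); rewrite [RHS]mulrCA.
Qed.
HB.instance Definition _ := GRing.isLinear.Build rat V V *:%R mix mix_linear.

Lemma embed_mix v j : embed (mix v) j = \sum_l pconst (M j l) * embed v l.
Proof.
apply/funext=> w; rewrite pser_sum /embed; case: insubP => [t _ tw|wm].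
  by rewrite ffunE /=; apply: eq_bigr => l _; rewrite pconstl -tw valK.
by rewrite big1 // => l _; rewrite pconstl insubN ?mulr0.
Qed.

Lemma gr_subst_mix y v : (forall i, y i [::] = 0) ->
  gr_subst y (mix v) = mix (gr_subst y v).
Proof.
move=> y0; apply/ffunP=> -[j t]; rewrite !ffunE /= embed_mix.
have -> : subst y (\sum_l pconst (M j l) * embed v l) = \sum_l pconst (M j l) * subst y (embed v l).
  elim/big_rec2: _ => [|l f g _ <-]; first by rewrite subst0.
  by rewrite substD // substZ.
by rewrite pser_sum; apply: eq_bigr => l _; rewrite pconstl ffunE.
Qed.

Hypothesis M_mod3 : forall i j, div3 (M i j - (i == j)%:R).

Lemma mix_one_mod3 : one_mod3 (@int_ffun X) mix.
Proof.
move=> v vZ; exists (3%:R^-1 *: (mix v - v)); last first.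
  by rewrite -scaler_nat scalerA mulfV // scale1r addrC subrK.
move=> -[j t]; rewrite !ffunE /=.
have -> : v (j, t) = \sum_l (j == l)%:R * v (l, t).
  rewrite (bigD1 j) //= eqxx mul1r big1 ?addr0 // => l lj.
  by rewrite eq_sym (negPf lj) mul0r.
rewrite -sumrB scaler_sumr; apply: rpred_sum => l _.
rewrite -mulrBl /GRing.scale /= mulrA; apply: rpredM; last exact: vZ.
by rewrite mulrC; apply: M_mod3.
Qed.
End Mixing.
End Graded.

(** * The norm equation for a substitution *)

Section GradedPowerSum.
Local Open Scope ring_scope.

Lemma ffun_power_sum_inj (X : finType) (T U : {additive {ffun X -> rat^o} -> {ffun X -> rat^o}})
    k v :
  (forall v, T (U v) = U (T v)) -> one_mod3 (@int_ffun X) T -> one_mod3 (@int_ffun X) U ->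
  (0 < k)%N -> power_sum T U k v = 0 -> v = 0.
Proof.
move=> TU T1 U1 k0 Fv; have [n vZ] := clear_denominators v.
apply: (@ffun_torsion_free _ n).
apply: (power_sum_inj (@ffun_torsion_free X) (@int_ffun0 X) (@int_ffunB X)
  (@int_ffun_divisible X) TU T1 U1 vZ k0).
by rewrite power_sumMn Fv mul0rn.
Qed.

Variable I : finType.
Implicit Types (f g h t : pser I).

Section IterSubst.
Variable y : I -> pser I.
Hypothesis y0 : forall i, y i [::] = 0.
Variable k : nat.
Notation phik := (iter k (subst y)).

Lemma iter_substB : {morph phik : f g / f - g}.
Proof. by move=> f g; elim: k => //= j ->; rewrite substB. Qed.
Lemma iter_substD : {morph phik : f g / f + g}.
Proof. by move=> f g; elim: k => //= j ->; rewrite substD. Qed.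
Lemma iter_substM : {morph phik : f g / f * g}.
Proof. by move=> f g; elim: k => //= j ->; rewrite substM. Qed.
Lemma iter_subst_const c : phik (pconst c) = pconst c.
Proof. by elim: k => //= j ->; rewrite subst_const. Qed.
Lemma iter_subst_nil f : phik f [::] = f [::].
Proof. by elim: k => //= j IH; rewrite subst_nil. Qed.
Lemma ord_ge_iter_subst n f : ord_ge n f -> ord_ge n (phik f).
Proof. by move=> F; elim: k => //= j; apply: ord_ge_subst. Qed.
End IterSubst.

Variable y : I -> pser I.
Hypothesis y0 : forall i, y i [::] = 0.
Hypothesis y_int : forall i, pint (y i).
Hypothesis y_mod3 : forall i j, div3 (y i [:: j] - (i == j)%:R).
Notation phi := (subst y).

(** On the graded piece the trace is [power_sum T 1 k], which is injective; the piece has finite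
    dimension over the rationals, so the trace is also onto. *)
Lemma graded_trace_surj m k f : (0 < k)%N -> ord_ge m f ->
  exists2 t, ord_ge m t & ord_ge m.+1 (\sum_(j < k) iter j phi t - f).
Proof.
move=> k0 fm; pose V := {ffun (unit * m.-tuple I) -> rat^o}.
pose T : {linear V -> V} := @gr_subst I unit m y.
have TE : T = @gr_subst I unit m y :> (V -> V) by [].
pose F (v : V) : V := \sum_(j < k) iter j T v.
have iterL j : linear (iter j T) by move=> a u v; elim: j => //= j ->; rewrite linearP.
have Flin : linear F.
  move=> a u v; rewrite /F scaler_sumr -big_split; apply: eq_bigr => j _; exact: iterL.
pose Fl : {linear V -> V} := HB.pack F (GRing.isLinear.Build rat V V *:%R F Flin).
have T1 : one_mod3 (@int_ffun _) T by apply: gr_subst_one_mod3.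
have FP v : power_sum T (@idfun V) k v = F v.
  by rewrite /F; elim: k {k0 F Flin Fl} => [|j IH] /=; rewrite ?big_ord0 // big_ord_recr /= -IH.
have Finj v : F v = 0 -> v = 0.
  rewrite -FP; apply: (@ffun_power_sum_inj _ T (@idfun V : {additive V -> V})) => //.
  by move=> u uZ; exists 0; rewrite ?mul0rn ?addr0 //; apply: int_ffun0.
have kerF : lker (linfun Fl) == 0%VS.
  apply/lker0P => u v; rewrite !lfunE /= => /eqP; rewrite -subr_eq0 -(linearB Fl).
  move=> /eqP /Finj /eqP.
  by rewrite subr_eq0 => /eqP.
pose v := ((linfun Fl)^-1)%VF (leading m (fun _ : unit => f)).
have Fv : F v = leading m (fun _ : unit => f).
  by have := lker0_lfunVK kerF (leading m (fun _ : unit => f)); rewrite lfunE.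
have tm := ord_ge_embed v tt.
exists (embed v tt) => //.
have H := @leading_eqP I unit m (fun j => \sum_(l < k) iter l phi (embed v j)) (fun _ => f).
apply: (H _ _ _ tt) => // [j|].
  by apply: ord_ge_sum => l _; apply: ord_ge_iter_subst => //; apply: ord_ge_embed.
rewrite -Fv; apply/ffunP=> -[j u]; rewrite ffunE /= pser_sum /F sum_ffunE.
apply: eq_bigr => l _.
have := @leading_iter_subst I unit m y y0 (embed v) l (ord_ge_embed v).
rewrite leading_embed => /ffunP/(_ (j, u)); rewrite ffunE /= => ->.
by rewrite TE.
Qed.

(** The product [h phi(h) ... phi^(k-1)(h)]. The [k]-th iterate of [phi] followed by conjugation by
    [h] is [phi^k] followed by conjugation by this product, so solving for [h] extracts a root of an
    inner factor. *)
Fixpoint twisted_norm k h : pser I :=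
  if k is k'.+1 then twisted_norm k' h * iter k' phi h else 1.

Lemma twisted_norm_nil k h : h [::] = 1 -> twisted_norm k h [::] = 1.
Proof.
by move=> h1; elim: k => //= k IH; rewrite pmul_nil IH iter_subst_nil // h1 mulr1.
Qed.

Lemma twisted_norm_congr n k g h :
  ord_ge n (g - h) -> ord_ge n (twisted_norm k g - twisted_norm k h).
Proof.
move=> gh; elim: k => [|k IH] /=; first by rewrite subrr; apply: ord_ge_zero.
apply: (@ord_ge_trans _ _ (twisted_norm k h * iter k phi g)).
  by rewrite -mulrBl; apply: ord_geMr.
rewrite -mulrBr -iter_substB //; apply: ord_geMl; exact: ord_ge_iter_subst.
Qed.

(** The linearization of the norm is the trace, because all factors have constant term 1. *)
Lemma twisted_normD m k h t : h [::] = 1 -> ord_ge m.+1 t ->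
  ord_ge m.+2 (twisted_norm k (h + t) - (twisted_norm k h + \sum_(j < k) iter j phi t)).
Proof.
move=> h1 tm; elim: k => [|k IH] /=.
  by rewrite big_ord0 addr0 subrr; apply: ord_ge_zero.
rewrite big_ord_recr /= iter_substD //.
have tk : ord_ge m.+1 (iter k phi t) by apply: ord_ge_iter_subst.
have Sm : ord_ge m.+1 (\sum_(j < k) iter j phi t).
  by apply: ord_ge_sum => j _; apply: ord_ge_iter_subst.
have B1 : ord_ge 1 (twisted_norm k h - 1).
  by apply: ord_ge1; rewrite pserB twisted_norm_nil // subrr.
have p1 : ord_ge 1 (iter k phi h - 1).
  by apply: ord_ge1; rewrite pserB iter_subst_nil // h1 subrr.
move: (twisted_norm k (h + t)) (twisted_norm k h) (\sum_(j < k) _) (iter k phi h) (iter k phi t)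
  IH tk Sm B1 p1.
move=> A B S p q IH tk Sm B1 p1.
(* On the right, the first summand has order at least [m.+2] by induction, and each other one is a
   product of a factor of order at least 1 and one of order at least [m.+1]. *)
have -> : A * (p + q) - (B * p + (S + q)) =
   (A - (B + S)) * (p + q) + ((B - 1) * q + (S * (p - 1) + S * q)).
  rewrite mulrBl -[in RHS]addrA; congr (_ + _).
  rewrite mulrBl mulrBr mul1r mulr1 mulrDl !mulrDr !opprD.
  move: (B * p) (B * q) (S * p) (S * q) => a b c d.
  rewrite !addrA [RHS](AC 9%AC (1*8*6*(2*5)*(3*7)*(4*9))).
  by rewrite /= !addNr !addr0.
apply: ord_geD; first exact: ord_geMr.
apply: ord_geD; first by rewrite -[m.+2]add1n; apply: ord_geM.
apply: ord_geD; first by rewrite -[m.+2]addn1; apply: ord_geM.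
rewrite -[m.+2]addn1; apply: ord_geM => //; exact: ord_ge_le tk.
Qed.

(** Successive approximation: at each stage the error in the lowest degree is a trace, and adding
    its preimage to [h] removes it. *)
Lemma twisted_norm_surj k g : (0 < k)%N -> g [::] = 1 ->
  exists2 h, h [::] = 1 & twisted_norm k h = g.
Proof.
move=> k0 g1.
pose P m h := h [::] = 1 /\ ord_ge m.+1 (twisted_norm k h - g).
have step m h : P m h -> exists h', P m.+1 h' /\ ord_ge m.+1 (h' - h).
  move=> [h1 hg]; have [t tm te] := graded_trace_surj k0 (ord_ge_sym hg).
  exists (h + t); split; last by rewrite addrC addKr.
  split; first by rewrite pserD h1 tm // addr0.
  apply: (ord_ge_trans (twisted_normD k h1 tm)).
  suff -> : twisted_norm k h + \sum_(j < k) iter j phi t - g =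
    \sum_(j < k) iter j phi t - (g - twisted_norm k h) by [].
  by rewrite opprB [RHS]addrCA [RHS]addrA.
pose next m h := if pselect (exists h', P m.+1 h' /\ ord_ge m.+1 (h' - h)) is left H
  then projT1 (cid H) else h.
pose hs := fix hs m := if m is m'.+1 then next m' (hs m') else (1 : pser I).
have hsP m : P m (hs m).
  elim: m => [|m IH] /=.
    split=> //; apply: ord_ge1.
    by rewrite pserB twisted_norm_nil // g1 subrr.
  by rewrite /next; case: pselect => [H|[]]; [case: (projT2 (cid H)) | apply: step].
have hsS m : ord_ge m.+1 (hs m.+1 - hs m).
  rewrite /= /next; case: pselect => [H|[]]; first by case: (projT2 (cid H)).
  exact/step/hsP.
have hsle n m : (n <= m)%N -> ord_ge n.+1 (hs m - hs n).
  elim: m => [|m IH]; first by rewrite leqn0 => /eqP ->; rewrite subrr; apply: ord_ge_zero.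
  rewrite leq_eqVlt => /predU1P[->|nm]; first by rewrite subrr; apply: ord_ge_zero.
  apply: ord_ge_trans (IH nm); apply: ord_ge_le (hsS m); exact: nm.
(* The limit is read off diagonally, as coefficients of words of length at most [n] no longer change
   after stage [n]. *)
pose h : pser I := fun w => hs (size w) w.
have hh n : ord_ge n.+1 (h - hs n).
  move=> w; rewrite ltnS => wn; rewrite pserB /h -pserB.
  by rewrite (ord_ge_sym (hsle _ _ wn)).
exists h; first by [].
apply/eqP; rewrite -subr_eq0; apply/eqP/ord_ge_eq0 => n.
apply: (@ord_ge_le _ n n.+1) => //.
apply: ord_ge_trans (proj2 (hsP n)); exact: twisted_norm_congr.
Qed.
End GradedPowerSum.

(** * Intertwining power series *)

Section Intertwiner.
Local Open Scope ring_scope.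
Variable I : finType.
Implicit Types (f g h t : pser I).

Section SkewDerivation.
Variables (D alpha beta : pser I -> pser I) (m : nat).
Hypotheses (DD : {morph D : f g / f + g}) (Dconst : forall c, D (pconst c) = 0).
Hypothesis DX : forall i f, D (pX i * f) = alpha (pX i) * D f + D (pX i) * beta f.
Hypothesis alphaX : forall i, ord_ge 1 (alpha (pX i)).
Hypothesis beta0 : forall f, beta f [::] = f [::].
Hypothesis DXm : forall i, ord_ge m (D (pX i)).

Lemma skew_expand f :
  D f = \sum_i (alpha (pX i) * D (dl i f) + D (pX i) * beta (dl i f)).
Proof.
have Dsum (F : I -> pser I) : D (\sum_i F i) = \sum_i D (F i).
  elim/big_rec2: _ => [|i u v _ <-]; last by rewrite DD.
  by have := Dconst 0; congr (D _ = _); apply/funext=> -[].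
rewrite {1}[f]pser_expand DD Dconst add0r Dsum.
by apply: eq_bigr => i _; rewrite DX.
Qed.

(** In the Leibniz expansion of [D f], a term contains either some [D (pX i)], of order [m], or [D]
    of a quotient multiplied by [alpha (pX i)], which gains one degree. *)
Lemma ord_ge_skew f : ord_ge m (D f).
Proof.
suff H n : forall f, (n <= m)%N -> ord_ge n (D f) by apply: H.
elim: n => [|n IH] {}f nm; first exact: ord_ge0.
rewrite skew_expand; apply: ord_ge_sum => i _; apply: ord_geD.
  by rewrite -add1n; apply: ord_geM => //; apply: IH; apply: ltnW.
by apply: ord_geMr; apply: ord_ge_le (DXm i).
Qed.

Lemma skew_lead f : ord_ge m.+1 (D f - \sum_i pconst (f [:: i]) * D (pX i)).
Proof.
rewrite skew_expand -sumrB; apply: ord_ge_sum => i _.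
rewrite -addrA; apply: ord_geD.
  by rewrite -add1n; apply: ord_geM => //; apply: ord_ge_skew.
rewrite -pconstC -mulrBr -addn1; apply: ord_geM => //.
by apply: ord_ge1; rewrite pserB beta0 subrr.
Qed.
End SkewDerivation.

Variables y z : I -> pser I.
Hypotheses (y0 : forall i, y i [::] = 0) (z0 : forall i, z i [::] = 0).
Hypothesis z_int : forall i, pint (z i).
Hypothesis y_mod3 : forall i j, div3 (y i [:: j] - (i == j)%:R).
Hypothesis z_mod3 : forall i j, div3 (z i [:: j] - (i == j)%:R).
Notation phi := (subst y).
Notation psi := (subst z).
Variable h : pser I.
Hypothesis h1 : h [::] = 1.
Notation N k := (twisted_norm z k h).

(** Its vanishing says that the norm intertwines [phi^k] with [psi^k]; for [k = 1] that is the
    relation sought for [h]. For fixed [k] it is a skew derivation in [f]. *)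
Definition defect k f := iter k phi f * N k - N k * iter k psi f.

(* Telescoping: modulo higher order, the right-hand side is the recursion that
   defines [power_sum], with [T] induced by [psi] and [U] by [phi]. *)
Lemma defectS k f :
  defect k.+1 f = defect k (phi f) * iter k psi h + N k * iter k psi (defect 1 f).
Proof.
rewrite /defect /= mul1r iter_substB // !iter_substM // mulrBl mulrBr !mulrA.
by rewrite -iterSr -[iter k psi (psi f)]iterSr /= addrA subrK.
Qed.

Lemma defectD k : {morph defect k : f g / f + g}.
Proof.
by move=> f g; rewrite /defect !iter_substD // mulrDl mulrDr opprD addrACA.
Qed.

Lemma defect_const k c : defect k (pconst c) = 0.
Proof. by rewrite /defect !iter_subst_const // pconstC subrr. Qed.

Lemma defectM k f g :
  defect k (f * g) = iter k phi f * defect k g + defect k f * iter k psi g.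
Proof.
rewrite /defect !iter_substM // mulrBr mulrBl !mulrA.
by rewrite addrA subrK.
Qed.

Lemma ord_ge_pX (i : I) : ord_ge 1 (pX i). Proof. exact: ord_ge1. Qed.

Lemma defect_ge m k : (forall i, ord_ge m (defect 1 (pX i))) ->
  forall f, ord_ge m (defect k f).
Proof.
move=> Dm; elim: k => [|k IH] f.
  by rewrite /defect /= mulr1 mul1r subrr; apply: ord_ge_zero.
have D1 g : ord_ge m (defect 1 g).
  apply: (@ord_ge_skew _ (iter 1 phi) (iter 1 psi)) => //.
  - exact: defectD.
  - exact: defect_const.
  - by move=> i t; apply: defectM.
  - by move=> i; apply/ord_ge_iter_subst/ord_ge_pX.
rewrite defectS; apply: ord_geD; first exact/ord_geMr/IH.
exact/ord_geMl/ord_ge_iter_subst.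
Qed.

Lemma defect_lead m k : (forall i, ord_ge m (defect 1 (pX i))) ->
  forall f, ord_ge m.+1 (defect k f - \sum_i pconst (f [:: i]) * defect k (pX i)).
Proof.
move=> Dm f; apply: (@skew_lead _ (iter k phi) (iter k psi)).
- exact: defectD.
- exact: defect_const.
- by move=> i t; apply: defectM.
- by move=> i; apply/ord_ge_iter_subst/ord_ge_pX.
- by move=> g; rewrite iter_subst_nil.
- by move=> i; apply: defect_ge.
Qed.

(** To leading order, [defect k (phi (pX i))] sees only the linear part of [y i], so [phi] acts by
    mixing the indices, while [psi] acts on the coefficients. These two actions commute, even though
    [phi] and [psi] need not. *)
Lemma defect_power_sum m k : (forall i, ord_ge m (defect 1 (pX i))) ->
  leading m (fun i => defect k (pX i)) =
  power_sum (@gr_subst I I m z) (@mix I I m (fun i j => y i [:: j])) k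
    (leading m (fun i => defect 1 (pX i))).
Proof.
move=> Dm; elim: k => [|k IH] /=.
  apply/ffunP=> -[i t]; rewrite !ffunE /defect /= mulr1 mul1r subrr.
  exact: pser0.
rewrite -IH -leading_iter_subst //.
apply: (@etrans _ _ (leading m (fun i =>
  (\sum_l pconst (y i [:: l]) * defect k (pX l)) + iter k psi (defect 1 (pX i))))).
  apply: leading_eq => i; rewrite defectS.
  (* Both multipliers in [defectS] are 1 up to order 1, so they disappear from the leading part. *)
  have Nk1 : ord_ge 1 (N k - 1).
    by apply: ord_ge1; rewrite pserB twisted_norm_nil // subrr.
  have hk1 : ord_ge 1 (iter k psi h - 1).
    by apply: ord_ge1; rewrite pserB iter_subst_nil // h1 subrr.
  rewrite opprD addrACA; apply: ord_geD.
    apply: (@ord_ge_trans _ _ (defect k (phi (pX i)))).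
      rewrite -[X in _ - X]mulr1 -mulrBr -addn1; apply: ord_geM => //.
      exact: defect_ge.
    rewrite subst_pX //; exact: defect_lead.
  rewrite -[X in _ - X]mul1r -mulrBl -add1n; apply: ord_geM => //.
  exact: ord_ge_iter_subst.
apply/ffunP=> -[i t]; rewrite !ffunE /= pserD; congr (_ + _).
by rewrite pser_sum; apply: eq_bigr => l _; rewrite pconstl ffunE.
Qed.

(** If [defect 1] has order at least [m] on the variables, its part of degree [m] is killed by an
    injective power sum; hence the order is at least [m.+1]. *)
Lemma intertwiner_unique k : (0 < k)%N -> (forall i, defect k (pX i) = 0) ->
  forall f, phi f * h = h * psi f.
Proof.
move=> k0 Dk.
have H m i : ord_ge m (defect 1 (pX i)).
  elim: m i => [|m IH] i; first exact: ord_ge0.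
  have Z : leading m (fun i => defect 1 (pX i)) = 0.
    apply: (@ffun_power_sum_inj _ (@gr_subst I I m z : {additive _ -> _})
             (@mix I I m (fun i j => y i [:: j]) : {additive _ -> _}) k) => //.
    - by move=> v; apply: gr_subst_mix.
    - exact: gr_subst_one_mod3.
    - exact: mix_one_mod3.
    rewrite -defect_power_sum //; apply/ffunP=> -[j t]; rewrite !ffunE /= Dk.
    exact: pser0.
  rewrite -[defect 1 _]subr0.
  apply: (leading_eqP (D := fun i => defect 1 (pX i)) (E := fun=> 0)) => //.
    by move=> j; apply: ord_ge_zero.
  rewrite Z; apply/ffunP=> -[j t]; rewrite !ffunE /=; exact/esym/pser0.
move=> f; apply/eqP; rewrite -subr_eq0; apply/eqP/ord_ge_eq0 => n.
have := @defect_ge n 1 (H n) f.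
by rewrite /defect /= mul1r.
Qed.
End Intertwiner.

Lemma intertwiner_exists (I : finType) (y z : I -> pser I) k (g : pser I) :
  (forall i, y i [::] = 0%R) -> (forall i, z i [::] = 0%R) ->
  (forall i, pint (z i)) ->
  (forall i j, div3 (y i [:: j] - (i == j)%:R)%R) ->
  (forall i j, div3 (z i [:: j] - (i == j)%:R)%R) ->
  0 < k -> g [::] = 1%R ->
  (forall i, iter k (subst y) (pX i) * g = g * iter k (subst z) (pX i))%R ->
  exists2 h : pser I, h [::] = 1%R & (forall f, subst y f * h = h * subst z f)%R.
Proof.
move=> y0 z0 zZ y3 z3 k0 g1 H.
have [h h1 hg] := twisted_norm_surj z0 zZ z3 k0 g1.
exists h => //; apply: (intertwiner_unique y0 z0 zZ y3 z3 h1 k0) => i.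
by rewrite /defect hg H subrr.
Qed.

(** * Syllables and cyclic coefficients *)

Section Units.
Local Open Scope ring_scope.
Variable I : eqType.
Implicit Types (f g p : pser I) (i j : I) (w : seq I).

Lemma invr_nil f : f [::] = 1 -> f^-1 [::] = 1.
Proof.
move=> f1; have := mulrV (pser_unit f1) => /(congr1 (fun q : pser I => q [::])).
by rewrite pmul_nil f1 mul1r.
Qed.

Lemma invr_geom f : f [::] = 1 -> f^-1 = geom (1 - f).
Proof.
move=> f1; have H : (1 - f) [::] = 0 by rewrite pserB f1 subrr.
have [+ _] := geom_unit H; rewrite subKr => E.
by apply: (mulIr (pser_unit f1)); rewrite mulVr ?pser_unit // E.
Qed.

Lemma pmul_lin f g j : (f * g) [:: j] = f [::] * g [:: j] + f [:: j] * g [::].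
Proof. by []. Qed.

Lemma invr_lin f j : f [::] = 1 -> f^-1 [:: j] = - f [:: j].
Proof.
move=> f1; have := mulrV (pser_unit f1) => /(congr1 (fun q : pser I => q [:: j])).
rewrite pmul_lin f1 mul1r invr_nil // mulr1 pone_cons => /eqP.
by rewrite addr_eq0 => /eqP.
Qed.

Lemma pint1 : pint (1 : pser I).
Proof. by move=> [|i w] //; apply: rpred0. Qed.
Lemma pintM f g : pint f -> pint g -> pint (f * g).
Proof. by move=> F G w; rewrite pmulE; apply: rpred_sum => s _; apply: rpredM. Qed.
Lemma pintB f g : pint f -> pint g -> pint (f - g).
Proof. by move=> F G w; rewrite pserB; apply: rpredB. Qed.
Lemma pintV f : f [::] = 1 -> pint f -> pint f^-1.
Proof.
move=> f1 F; rewrite invr_geom // => w; rewrite /geom pser_sum; apply: rpred_sum => j _.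
suff: pint ((1 - f) ^+ j) by apply.
elim: (j : nat) => [|l IH]; first exact: pint1.
by rewrite exprS; apply: pintM => //; apply: pintB => //; apply: pint1.
Qed.

Definition only i f := forall w, ~~ all (pred1 i) w -> f w = 0.

Lemma only1 i : only i 1. Proof. by case. Qed.
Lemma onlyB i f g : only i f -> only i g -> only i (f - g).
Proof. by move=> F G w wi; rewrite pserB F // G // subrr. Qed.
Lemma onlyM i f g : only i f -> only i g -> only i (f * g).
Proof.
move=> F G w wi; rewrite pmulE big1 // => s _.
move: wi; rewrite -{1}(cat_take_drop s w) all_cat negb_and => /orP[H|H].
  by rewrite F // mul0r.
by rewrite G // mulr0.
Qed.
Lemma onlyX i f n : only i f -> only i (f ^+ n).
Proof. by move=> F; elim: n => [|n IH]; [exact: only1 | rewrite exprS; apply: onlyM]. Qed.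
Lemma onlyV i f : f [::] = 1 -> only i f -> only i f^-1.
Proof.
move=> f1 F; rewrite invr_geom // => w wi; rewrite /geom pser_sum big1 // => j _.
apply: (@onlyX i) wi; apply: onlyB => //; exact: only1.
Qed.

Lemma only_dl i j f : only i f -> i != j -> dl j f = 0.
Proof.
by move=> F ij; apply/funext=> w; rewrite pser0 /dl F //= eq_sym (negPf ij).
Qed.

Lemma onlyM_neq i j p f w : only i p -> p [::] = 1 -> i != j ->
  (p * f) (j :: w) = f (j :: w).
Proof.
move=> P p1 ij; rewrite pmul_cons p1 mul1r (only_dl P ij) mul0r.
by rewrite pser0 addr0.
Qed.

(** Since [w] does not begin with [i], only the prefixes [[::]] and [[:: i]] can be taken from
    [p]. *)
Lemma onlyM_eq i p f w : only i p -> p [::] = 1 -> path (fun a b => a != b) i w ->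
  (p * f) (i :: w) = f (i :: w) + p [:: i] * f w.
Proof.
move=> P p1 iw; rewrite pmul_cons p1 mul1r; congr (_ + _).
case: w iw => [|j w] //= /andP[ij _]; rewrite pmul_cons.
have -> : dl j (dl i p) = 0.
  by apply/funext=> u; rewrite pser0 /dl P //= eqxx eq_sym (negPf ij).
by rewrite mul0r pser0 addr0.
Qed.

(** A trace on power series: by [cyclic_coefC] it is invariant under conjugation. *)
Definition cyclic_coef w f := \sum_(r < size w) f (rot r w).

Lemma sum_rot (H : seq I -> rat) w s : (s <= size w)%N ->
  \sum_(r < size w) H (rot s (rot r w)) = \sum_(r < size w) H (rot r w).
Proof.
elim: s H => [|s IH] H sw; first by apply: eq_bigr => r _; rewrite rot0.
transitivity (\sum_(r < size w) H (rot 1 (rot s (rot r w)))).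
  by apply: eq_bigr => r _; rewrite -rotS // size_rot.
rewrite (IH (fun u => H (rot 1 u))) ?(ltnW sw) //.
transitivity (\sum_(r < size w) H (rot r.+1 w)).
  by apply: eq_bigr => r _; rewrite -rotS.
case: (size w) sw (rot_size w) => // n _ En.
by rewrite big_ord_recr [RHS]big_ord_recl /= En rot0 addrC.
Qed.

(** Both sides sum over a rotation of [w] and a splitting point; rotating further by the splitting
    point exchanges the two pieces. *)
Lemma cyclic_coefC w f g : cyclic_coef w (f * g) = cyclic_coef w (g * f).
Proof.
pose H (s : nat) u := g (take s u) * f (drop s u).
transitivity (\sum_(r < size w) \sum_(s < (size w).+1) H (size w - s)%N (rot s (rot r w))).
  apply: eq_bigr => r _; rewrite pmulE size_rot; apply: eq_bigr => s _.
  rewrite mulrC /H; move: (rot r w) (size_rot r w) => u su.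
  by rewrite /rot take_size_cat ?drop_size_cat ?size_drop ?su.
rewrite exchange_big /= (reindex_inj rev_ord_inj) /=.
transitivity (\sum_(s < (size w).+1) \sum_(r < size w) H s (rot r w)).
  apply: eq_bigr => s _; rewrite subSS subKn; last by rewrite -ltnS.
  by rewrite (sum_rot (H s)) // leq_subr.
by rewrite exchange_big; apply: eq_bigr => r _; rewrite pmulE size_rot.
Qed.
End Units.

(** * Normal forms as products of powers of [1 + X_i] *)

Section Syllables.
Local Open Scope ring_scope.
Variable I : finType.
Implicit Types (f g p : pser I) (i j : I) (m w : seq I) (s : seq (I * int)).

Definition xvar i : pser I := 1 + pX i.
Definition xpow i (n : int) : pser I := xvar i ^ n.

Lemma xvarE i w : xvar i w = (1 : pser I) w + pX i w. Proof. by []. Qed.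
Lemma xvar_nil i : xvar i [::] = 1. Proof. by rewrite xvarE pone_nil addr0. Qed.
Lemma xvar_unit i : xvar i \is a GRing.unit. Proof. exact/pser_unit/xvar_nil. Qed.
Lemma xvar_lin i j : xvar i [:: j] = (i == j)%:R.
Proof. by rewrite xvarE pone_cons add0r /pX eqseq_cons andbT eq_sym. Qed.
Lemma only_xvar i : only i (xvar i).
Proof.
move=> w wi; rewrite xvarE (only1 wi) add0r /pX; case: eqP wi => // ->.
by rewrite /= eqxx.
Qed.

Lemma xvarX_nil i n : (xvar i ^+ n) [::] = 1.
Proof. by elim: n => // n IH; rewrite exprS pmul_nil IH xvar_nil. Qed.
Lemma xvarX_lin i j n : (xvar i ^+ n) [:: j] = (i == j)%:R * n%:R.
Proof.
elim: n => [|n IH]; first by rewrite mulr0.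
by rewrite exprS pmul_lin xvar_nil xvarX_nil IH xvar_lin mul1r mulr1 -natr1 mulrDr mulr1.
Qed.

Lemma xpow_nil i n : xpow i n [::] = 1.
Proof. by case: n => n; [exact: xvarX_nil | exact: (invr_nil (xvarX_nil i n.+1))]. Qed.
Lemma xpow_lin i j n : xpow i n [:: j] = (i == j)%:R * n%:~R.
Proof.
case: n => n; first exact: xvarX_lin.
rewrite -[LHS]/((xvar i ^+ n.+1)^-1 [:: j]) invr_lin ?xvarX_nil // xvarX_lin.
by rewrite NegzE mulrNz mulrN.
Qed.
Lemma only_xpow i n : only i (xpow i n).
Proof.
case: n => n; first exact/onlyX/only_xvar.
rewrite -[xpow _ _]/((xvar i ^+ n.+1)^-1); apply: onlyV; first exact: xvarX_nil.
exact/onlyX/only_xvar.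
Qed.
Lemma xpowD i a b : xpow i (a + b) = xpow i a * xpow i b.
Proof. exact/exprzDr/xvar_unit. Qed.
Lemma xpow1 i : xpow i 1 = xvar i. Proof. by []. Qed.

Definition syl_eval s : pser I := \prod_(x <- s) xpow x.1 x.2.
Definition syl_ok s := sorted (fun a b => a != b) (map fst s) && all (fun x => x.2 != 0) s.

(** A word without equal neighbours takes at most one letter from each syllable. Being at least as
    long as [s], it must take exactly one from each, and the linear coefficient of [(1 + X_i)^n] is
    [n]. *)
Lemma syl_coef s m : sorted (fun a b => a != b) (map fst s) ->
  sorted (fun a b => a != b) m -> (size s <= size m)%N ->
  syl_eval s m = if m == map fst s then \prod_(x <- s) (x.2)%:~R else 0.
Proof.
rewrite /syl_eval; elim: s m => [|[i a] s IH] [|j m] //= ss sm sz; rewrite ?big_nil //.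
rewrite !big_cons /= eqseq_cons.
have ss' := path_sorted ss; have sm' := path_sorted sm.
have Z : (\prod_(x <- s) xpow x.1 x.2) (j :: m) = 0.
  rewrite IH //=; last exact: leqW.
  by case: eqP => // /(congr1 size) /=; rewrite size_map => E; rewrite -E ltnn in sz.
have [ji|ij] /= := eqVneq j i; last first.
  by rewrite (onlyM_neq _ _ (@only_xpow i a) (xpow_nil i a)) // eq_sym.
rewrite {j}ji in sm Z *.
rewrite (onlyM_eq _ (@only_xpow i a) (xpow_nil i a)) // Z add0r xpow_lin eqxx mul1r.
by rewrite IH //; case: eqP => // _; rewrite mulr0.
Qed.

Lemma syl_prod_neq0 s : syl_ok s -> \prod_(x <- s) (x.2)%:~R != 0 :> rat.
Proof.
move=> /andP[_ /allP H]; rewrite prodf_seq_neq0; apply/allP => x xs /=.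
by rewrite intr_eq0 H.
Qed.

Lemma syl_eval_neq1 s : syl_ok s -> s != [::] -> syl_eval s != 1.
Proof.
move=> sok s0; apply/eqP => /(congr1 (fun f : pser I => f (map fst s))).
have /andP[ss _] := sok.
rewrite syl_coef ?size_map // eqxx => E; have := syl_prod_neq0 sok.
by rewrite E; case: s s0 {E sok ss} => //= x s _; rewrite eqxx.
Qed.
End Syllables.

(** * The Magnus embedding *)

Section Magnus.
Local Open Scope ring_scope.
Variable N : nat.
Notation A := (pser 'I_N).
Implicit Types (a b : letter N) (u v w : seq (letter N)) (i j : 'I_N) (f g h : A).

Definition letter_sign a : int := if a.2 then -1 else 1.
Definition magnus_letter a : A := xpow a.1 (letter_sign a).
Definition magnus w : A := \prod_(a <- w) magnus_letter a.

Lemma magnus_cons a w : magnus (a :: w) = magnus_letter a * magnus w.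
Proof. exact: big_cons. Qed.
Lemma magnus_cat u v : magnus (u ++ v) = magnus u * magnus v.
Proof. exact: big_cat. Qed.
Lemma magnus_gen i : magnus (gen i) = xvar i.
Proof. by rewrite /magnus big_seq1. Qed.

Lemma magnus_nil w : magnus w [::] = 1.
Proof.
rewrite /magnus; elim: w => [|a w IH]; first by rewrite big_nil.
by rewrite big_cons pmul_nil IH /magnus_letter xpow_nil.
Qed.
Lemma magnus_unit w : magnus w \is a GRing.unit.
Proof. exact/pser_unit/magnus_nil. Qed.

Lemma inv_letterK : involutive (@inv_letter N).
Proof. by case=> i b; rewrite /inv_letter /= negbK. Qed.

Lemma magnus_inv_letter a : magnus_letter (inv_letter a) = (magnus_letter a)^-1.
Proof.
case: a => i [] /=; rewrite /magnus_letter /inv_letter /letter_sign /=.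
  by rewrite /xpow exprN1 invrK.
by rewrite /xpow exprN1.
Qed.

Lemma magnus_letter_unit a : magnus_letter a \is a GRing.unit.
Proof. exact/pser_unit/xpow_nil. Qed.

Lemma magnus_inv w : magnus (Defs.finv w) = (magnus w)^-1.
Proof.
elim: w => [|a w IH]; first by rewrite /magnus !big_nil GRing.invr1.
rewrite /Defs.finv map_cons rev_cons -cats1 magnus_cat -/(Defs.finv w) IH
  [magnus (a :: w)]magnus_cons.
rewrite invrM ?magnus_letter_unit ?magnus_unit //; congr (_ * _).
by rewrite /magnus big_seq1 magnus_inv_letter.
Qed.

Lemma magnus_reduce w : magnus (reduce w) = magnus w.
Proof.
elim: w => //= a w IH; rewrite magnus_cons -IH.
case: (reduce w) => [|b v] //=; first by rewrite magnus_cons.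
case: eqP => [->|_]; last by rewrite magnus_cons.
by rewrite magnus_cons mulrA magnus_inv_letter mulrV ?magnus_letter_unit // mul1r.
Qed.

Lemma magnus_mul u v : magnus (fmul u v) = magnus u * magnus v.
Proof. by rewrite magnus_reduce magnus_cat. Qed.

Lemma pint_magnus w : pint (magnus w).
Proof.
have X i : pint (xvar i).
  move=> u; rewrite xvarE; apply: rpredD; first exact: pint1.
  exact: rpred_nat.
rewrite /magnus; elim: w => [|a w IH]; first by rewrite big_nil; apply: pint1.
rewrite big_cons; apply: pintM => //; rewrite /magnus_letter /letter_sign /xpow.
case: a.2; last exact: X.
by rewrite exprN1; apply: pintV => //; apply: xvar_nil.
Qed.

Lemma magnus_lin w j : magnus w [:: j] = (expsum j w)%:~R.
Proof.
rewrite /expsum /magnus; elim: w => [|a w IH]; first by rewrite !big_nil.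
rewrite !big_cons pmul_lin /magnus_letter xpow_nil mul1r IH xpow_lin -/(magnus w) magnus_nil mulr1.
rewrite /letter_sign; case: eqP => _; last by rewrite mul0r addr0.
by rewrite mul1r rmorphD addrC.
Qed.

(** Chosen so that [1 + X_i] is sent to [magnus (s i)], with no constant term left in the image of
    [X_i]. *)
Definition subst_of (s : endo N) : 'I_N -> A := fun i => magnus (s i) - 1.
Notation act s := (subst (subst_of s)).

Lemma subst_of_nil s i : subst_of s i [::] = 0.
Proof. by rewrite /subst_of pserB magnus_nil subrr. Qed.

Lemma pint_subst_of s i : pint (subst_of s i).
Proof. by apply: pintB; [apply: pint_magnus | apply: pint1]. Qed.

Lemma subst_of_mod3 s i j : IA3 s -> div3 (subst_of s i [:: j] - (i == j)%:R).
Proof.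
move=> /(_ i j); rewrite eqz_mod_dvd => /dvdzP[q Eq].
rewrite /subst_of pserB pone_cons subr0 magnus_lin.
have -> : (i == j)%:R = ((i == j)%:Z)%:~R :> rat by [].
by rewrite -rmorphB Eq rmorphM /div3 /= mulfK // intr_int.
Qed.

Lemma act_xvar s i : act s (xvar i) = magnus (s i).
Proof.
rewrite /xvar substD ?subst1 ?subst_pX; last exact: subst_of_nil.
all: try exact: subst_of_nil.
by rewrite addrC subrK.
Qed.

Lemma act_inv s f : f [::] = 1 -> act s f^-1 = (act s f)^-1.
Proof.
move=> f1; have s0 := subst_of_nil s.
have u1 : act s f \is a GRing.unit by apply: pser_unit; rewrite subst_nil.
by apply: (mulIr u1); rewrite mulVr // -substM // mulVr ?subst1 // pser_unit.
Qed.

Lemma act_magnus s w : act s (magnus w) = magnus (apply s w).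
Proof.
have s0 := subst_of_nil s.
rewrite /apply magnus_reduce; elim: w => [|a w IH] /=.
  by rewrite /magnus !big_nil subst1.
rewrite magnus_cat magnus_cons substM // IH; congr (_ * _).
rewrite /magnus_letter /letter_sign /xpow; case: a.2; last exact: act_xvar.
by rewrite exprN1 act_inv ?xvar_nil // act_xvar magnus_inv.
Qed.

Lemma act_power s k i : iter k (act s) (xvar i) = magnus (power s k i).
Proof.
elim: k => [|k IH]; first by rewrite magnus_gen.
by rewrite iterS IH act_magnus.
Qed.

Definition is_reduced w := sorted (fun a b => b != inv_letter a) w.

Lemma reduce_reduced w : is_reduced (reduce w).
Proof.
elim: w => //= a w; case: (reduce w) => [|b v] //= H.
case: eqP => [_|/eqP ab]; first exact: path_sorted H.
by rewrite /is_reduced /= ab.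
Qed.

(* The sign of the first exponent is recorded so that prepending a letter to a
   reduced word can never cancel that exponent. *)
Lemma reduced_syllables w : is_reduced w ->
  exists s : seq ('I_N * int), [/\ syl_ok s, syl_eval s = magnus w &
    if w is a :: _ then exists n s', s = (a.1, letter_sign a * n.+1%:Z) :: s' else s = [::]].
Proof.
elim: w => [|b w IH] bw.
  by exists [::]; split => //; rewrite /syl_eval /magnus !big_nil.
have [s [sok sw hs]] := IH (path_sorted bw).
have b0 n : letter_sign b * n.+1%:Z != 0 by rewrite mulf_neq0 // /letter_sign; case: b.2.
case: w bw hs sw {IH} => [_ -> _|a w /= /andP[ab aw] [n [s' Es]] sw].
  exists [:: (b.1, letter_sign b * 1)]; split.
  - by rewrite /syl_ok /= b0.
  - by rewrite /syl_eval /magnus !big_seq1 mulr1.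
  - by exists 0%N, [::].
have [ba|ba] := eqVneq b.1 a.1.
  have eab : a = b.
    move: ab ba; case: a {aw Es sw} => i e; case: b {b0} => j e' /=.
    rewrite /inv_letter /= => H ji; rewrite ji in H *.
    by move: H; case: e; case: e'; rewrite ?eqxx.
  subst a; exists ((b.1, letter_sign b * n.+2%:Z) :: s'); split.
  - by move: sok; rewrite Es /syl_ok /= !b0.
  - rewrite magnus_cons -sw Es /syl_eval !big_cons /= mulrA; congr (_ * _).
    by rewrite /magnus_letter -xpowD -[X in X + _]mulr1 -mulrDr -intS.
  - by exists n.+1, s'.
exists ((b.1, letter_sign b * 1) :: s); split.
- by move: sok; rewrite Es /syl_ok /= ba (b0 0%N).
- by rewrite magnus_cons -sw /syl_eval big_cons mulr1.
- by exists 0%N, s.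
Qed.

Lemma reduced_magnus_neq1 w : is_reduced w -> w != [::] -> magnus w != 1.
Proof.
move=> /reduced_syllables[s [sok <- hs]]; case: w hs => // a w [n [s' Es]] _.
by apply: syl_eval_neq1 => //; rewrite Es.
Qed.

Lemma reduced_finv w : is_reduced w -> is_reduced (Defs.finv w).
Proof.
rewrite /is_reduced /Defs.finv rev_sorted sorted_map; apply: sub_sorted => a b /=.
by rewrite inv_letterK eq_sym.
Qed.

(** Equal first letters are cancelled. If the first letters differ, the inverse of one word followed
    by the other is reduced and nonempty, so its image cannot be 1. *)
Lemma magnus_inj u v : is_reduced u -> is_reduced v -> magnus u = magnus v -> u = v.
Proof.
have one w : magnus [::] = magnus w -> is_reduced w -> w = [::].
  move=> E rw; apply/eqP/negPn/negP => w0.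
  by have := reduced_magnus_neq1 rw w0; rewrite -E /magnus big_nil eqxx.
elim: u v => [|a u IH] [|b v] ru rv E //.
- exact/esym/one.
- exact/one.
have [ab|ab] := eqVneq a b.
  rewrite -ab in rv E *; congr (_ :: _); apply: IH; try exact: path_sorted.
    exact: path_sorted ru.
    exact: path_sorted rv.
  by move: E; rewrite !magnus_cons; apply/mulrI/magnus_letter_unit.
have E1 : magnus (Defs.finv (a :: u) ++ b :: v) = magnus [::].
  by rewrite magnus_cat magnus_inv E mulVr ?magnus_unit // /magnus big_nil.
have := one _ (esym E1); rewrite /Defs.finv map_cons rev_cons cat_rcons => H.
suff /H : is_reduced (rev (map (@inv_letter N) u) ++ inv_letter a :: b :: v) by case: (rev _).
have := reduced_finv ru; rewrite /is_reduced /Defs.finv map_cons rev_cons.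
case: (rev _) => [|c r] /=.
  by rewrite inv_letterK eq_sym ab.
by rewrite rcons_path cat_path /= inv_letterK (eq_sym b) ab => /andP[-> ->].
Qed.

Definition in_free f := exists w, f = magnus w.

Lemma in_freeM f g : in_free f -> in_free g -> in_free (f * g).
Proof. by move=> [u ->] [v ->]; exists (u ++ v); rewrite magnus_cat. Qed.
Lemma in_freeV f : in_free f -> in_free f^-1.
Proof. by move=> [u ->]; exists (Defs.finv u); rewrite magnus_inv. Qed.
Lemma in_free1 : in_free 1.
Proof. by exists [::]; rewrite /magnus big_nil. Qed.
Lemma in_free_nil f : in_free f -> f [::] = 1.
Proof. by move=> [w ->]; apply: magnus_nil. Qed.
Lemma in_free_xpow i n : in_free (xpow i n).
Proof.
have X m : in_free (xvar i ^+ m).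
  elim: m => [|m IH]; first exact: in_free1.
  by rewrite exprS; apply: in_freeM => //; exists (gen i); rewrite magnus_gen.
by case: n => n; [apply: X | apply/in_freeV/X].
Qed.

Lemma magnus_syllables w : exists2 s : seq ('I_N * int), syl_ok s & magnus w = syl_eval s.
Proof.
have [s [sok sw _]] := reduced_syllables (reduce_reduced w).
by exists s => //; rewrite sw magnus_reduce.
Qed.
End Magnus.

(** * Conjugation by power series *)

Section Conjugation.
Local Open Scope ring_scope.
Variable N : nat.
Notation A := (pser 'I_N).
Implicit Types (s t : seq ('I_N * int)) (i j : 'I_N) (f g h : A) (w m : seq 'I_N).

Lemma syl_eval_cons x s : syl_eval (x :: s) = xpow x.1 x.2 * syl_eval s.
Proof. exact: big_cons. Qed.
Lemma syl_eval_rcons s x : syl_eval (rcons s x) = syl_eval s * xpow x.1 x.2.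
Proof. by rewrite /syl_eval -cats1 big_cat big_seq1. Qed.
Lemma xpow_unit i n : xpow i n \is a GRing.unit.
Proof. exact/pser_unit/xpow_nil. Qed.

Lemma syl_ok_cat s t : syl_ok (s ++ t) -> syl_ok s /\ syl_ok t.
Proof.
rewrite /syl_ok map_cat all_cat => /andP[/cat_sorted2[ss tt] /andP[sa ta]].
by rewrite ss tt sa ta.
Qed.

(** By [syl_coef], a rotation contributes only if it fixes the letter sequence, and then always the
    same nonzero product of exponents; the trivial rotation is one of these. *)
Lemma cyclic_coef_syl s : syl_ok s -> cycle (fun a b => a != b) (map fst s) -> s != [::] ->
  cyclic_coef (map fst s) (syl_eval s) != 0.
Proof.
move=> sok cyc s0; have /andP[ss _] := sok.
have E (r : 'I_(size (map fst s))) : syl_eval s (rot r (map fst s)) =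
    if rot r (map fst s) == map fst s then \prod_(x <- s) (x.2)%:~R else 0.
  rewrite syl_coef // ?size_rot ?size_map //.
  have : cycle (fun a b => a != b) (rot r (map fst s)) by rewrite rot_cycle.
  by case: (rot _ _) => //= a p; rewrite rcons_path => /andP[].
rewrite /cyclic_coef (eq_bigr _ (fun r _ => E r)) -big_mkcond sumr_const /=.
rewrite mulrn_eq0 negb_or syl_prod_neq0 // andbT -lt0n.
have n0 : (0 < size (map fst s))%N by rewrite size_map lt0n size_eq0.
by apply/card_gt0P; exists (Ordinal n0); rewrite unfold_in; apply/eqP; exact: rot0.
Qed.

Lemma cyclic_coef_xvar i m : (1 < size m)%N -> cyclic_coef m (xvar i) = 0.
Proof.
move=> m1; rewrite /cyclic_coef big1 // => r _; rewrite xvarE.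
have : (1 < size (rot r m))%N by rewrite size_rot.
by case: (rot r m) => [|a [|b u]] //= _; rewrite pone_cons add0r /pX eqseq_cons andbF.
Qed.

(* If the two end syllables of [s] carry different letters, the cyclic coefficient
   of [s] at its own sequence of letters is nonzero, while that of [xvar i] is zero;
   otherwise conjugating by the first syllable shortens [s]. *)
Lemma conj_xvar_in_free i s h : syl_ok s -> h [::] = 1 ->
  syl_eval s * h = h * xvar i ->
  exists2 v, in_free v & syl_eval s * v = v * xvar i.
Proof.
have [n] := ubnP (size s); elim: n s h => // n IH s h sn sok h1 E.
case: s sn sok E => [|[j a] s] sn sok E.
  have := congr1 (fun f : A => f [:: i]) E.
  rewrite /syl_eval big_nil mul1r pmul_lin xvar_nil xvar_lin h1 eqxx !mulr1 => /eqP.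
  by rewrite eq_sym -subr_eq0 addrK oner_eq0.
case/lastP: s sn sok E => [|s [k b]] sn sok E.
  (* For a single syllable, the coefficient of [X_i] forces [j = i] and [a = 1]. *)
  have := congr1 (fun f : A => f [:: i]) E.
  rewrite syl_eval_cons {1}/syl_eval big_nil mulr1 !pmul_lin /= xpow_nil xpow_lin xvar_nil.
  rewrite xvar_lin h1 eqxx !mulr1 mul1r addrC => /addIr.
  case: eqP => [ji|_]; last by rewrite mul0r => /eqP; rewrite eq_sym oner_eq0.
  rewrite mul1r => /(@intr_inj _ _ 1) a1; exists 1; first exact: in_free1.
  by rewrite /syl_eval ?big_nil !mulr1 mul1r /= ji a1 xpow1.
have [jk|jk] := eqVneq j k; last first.
  have c0 := @cyclic_coef_syl _ sok.
  have Es : syl_eval ((j, a) :: rcons s (k, b)) = h * (xvar i * h^-1).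
    by rewrite mulrA -E mulrK // pser_unit.
  suff: cyclic_coef (map fst ((j, a) :: rcons s (k, b))) (syl_eval ((j, a) :: rcons s (k, b))) == 0.
    move=> /idPn[]; apply: c0 => //.
    have /andP[/= ss _] := sok.
    by rewrite /= map_rcons rcons_path -map_rcons ss map_rcons last_rcons eq_sym.
  rewrite Es cyclic_coefC -mulrA mulVr ?pser_unit // mulr1 cyclic_coef_xvar //.
  by rewrite /= size_map size_rcons.
subst k.
have [_ sab] := @syl_ok_cat [:: (j, a)] (rcons s (j, b)) sok.
have [sok' _] : syl_ok s /\ syl_ok [:: (j, b)] by apply: syl_ok_cat; rewrite cats1.
(* Conjugation moves the first syllable to the end, where it merges with the last one; if the
   exponents cancel, the merged syllable is dropped to keep a normal form. *)
pose s2 := if b + a == 0 then s else rcons s (j, b + a).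
have Es2 : syl_eval s2 = syl_eval s * xpow j (b + a).
  by rewrite /s2; case: eqP => [->|_]; rewrite ?mulr1 // syl_eval_rcons.
have s2n : (size s2 < n)%N.
  move: sn; rewrite /= size_rcons ltnS /s2; case: ifP => _; rewrite ?size_rcons //.
  exact: ltnW.
have s2ok : syl_ok s2.
  rewrite /s2; case: eqP => // /eqP ba; move: sab; rewrite /syl_ok !map_rcons !all_rcons /= ba.
  by move=> /andP[-> /andP[_ ->]].
have u := xpow_unit j a.
have Es (f : A) : syl_eval ((j, a) :: rcons s (j, b)) * (xpow j a * f) =
    xpow j a * (syl_eval s2 * f).
  by rewrite syl_eval_cons syl_eval_rcons Es2 xpowD /= !mulrA.
have [v vF Ev] : exists2 v, in_free v & syl_eval s2 * v = v * xvar i.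
  apply: (IH s2 ((xpow j a)^-1 * h)) => //.
    by rewrite pmul_nil invr_nil ?xpow_nil // h1 mulr1.
  by apply: (mulrI u); rewrite -Es mulVKr // E !mulrA mulrV // mul1r.
exists (xpow j a * v); first by apply: in_freeM => //; apply: in_free_xpow.
by rewrite Es Ev mulrA.
Qed.

Lemma pXMr_rcons i f w : (f * pX i) (rcons w i) = f w.
Proof.
elim: w f => [|k w IH] f; first by rewrite /= pmul_lin /pX eqxx mulr1 mulr0 addr0.
rewrite rcons_cons pmul_cons IH /pX eqseq_cons.
by case: (w) => [|? ?]; rewrite /= andbF mulr0 add0r.
Qed.

(** Commuting with [X_i] makes the coefficient at a nonempty word vanish unless the word begins with
    [i], and otherwise allows that [i] to be moved to the end. Repeating this brings any other
    letter to the front. *)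
Lemma only_commute i h : h * xvar i = xvar i * h -> only i h.
Proof.
rewrite /xvar mulrDl mulrDr mulr1 mul1r => /addrI E.
have step w : h w = (pX i * h) (rcons w i) by rewrite -E pXMr_rcons.
suff H w n : ~~ all (pred1 i) w -> h (w ++ nseq n i) = 0.
  by move=> w wi; rewrite -(H w 0%N wi) cats0.
elim: w n => //= j w IH n; rewrite step rcons_cons pXM_cons eq_sym.
case: eqP => [_|_] /= wi; last by rewrite mul0r.
have -> : rcons (w ++ nseq n i) i = w ++ nseq n.+1 i.
  by rewrite -cats1 -catA -[[:: i]]/(nseq 1 i) -nseqD addn1.
by rewrite IH // mulr0.
Qed.

(** At the letter sequence of [t] the left side is the nonzero product of exponents. The right side
    is the coefficient of [1 + X_j], as [f2] cannot supply the first letter; so the sequence is the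
    single letter [j]. The default [j] in [head] and [last] covers an empty [t]. *)
Lemma only_intertwine i j t f1 f2 : i != j -> only i f1 -> only i f2 ->
  f1 [::] = 1 -> f2 [::] = 1 -> syl_ok t ->
  head j (map fst t) != i -> last j (map fst t) != i ->
  syl_eval t * f1 = f2 * xvar j -> f2 = 1.
Proof.
move=> ij F1 F2 f11 f21 tok hd lt E.
have fj f : only i f -> f [:: j] = 0 by move=> F; apply: F; rewrite /= andbT (eq_sym j) ij.
case: t tok hd lt E => [|[k a] t] tok hd lt E.
  have := congr1 (fun f : A => f [:: j]) E.
  rewrite /syl_eval big_nil mul1r pmul_lin (fj _ F1) (fj _ F2) mul0r addr0 f21 mul1r xvar_lin eqxx.
  by move/eqP; rewrite eq_sym oner_eq0.
have /andP[ss _] := tok.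
have P0 : (syl_eval ((k, a) :: t) * f1) (map fst ((k, a) :: t)) != 0.
  rewrite pmulE big_ord_recr /= take_size drop_size f11 mulr1 big1 ?add0r.
    by rewrite syl_coef /= ?size_map // eqxx; apply: (syl_prod_neq0 tok).
  (* A nonempty suffix contains the last letter, which is not [i], so [f1] vanishes on it. *)
  move=> r _; rewrite F1 ?mulr0 //; apply/negP => /allP/(_ (last k (map fst t))).
  rewrite /= (negPf lt) => /(_ _)/notF; apply.
  have := ltn_ord r; rewrite /=; move: (map fst t) (r : nat) => m' r' rm.
  have : (0 < size (drop r' (k :: m')))%N by rewrite size_drop subn_gt0.
  have : last k (take r' (k :: m') ++ drop r' (k :: m')) = last k m'.
    by rewrite cat_take_drop.
  by rewrite last_cat; case: (drop r' _) => //= c d <- _; apply: mem_last.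
have {P0} : xvar j (k :: map fst t) != 0.
  by rewrite -(@onlyM_neq _ i k f2 (xvar j)) ?(eq_sym i) // -E.
rewrite xvarE pone_cons add0r /pX eqseq_cons.
case: (k =P j) => [kj|_] //=; case: t tok hd lt E ss => //= tok hd lt E ss _.
apply/funext=> w; have [wi|wi] := boolP (all (pred1 i) w); last by rewrite F2 // (only1 wi).
case: w wi => [|c w] //= /andP[/eqP ci wi]; rewrite pone_cons ci.
(* Appending [j] isolates [f2 (i :: w)]: at this word the right side is that coefficient, while the
   left side is zero. *)
have ni : ~~ all (pred1 i) (rcons (i :: w) j) by rewrite all_rcons /= eq_sym (negPf ij).
have := congr1 (fun f : A => f (rcons (i :: w) j)) E.
rewrite {1}rcons_cons syl_eval_cons /syl_eval big_nil mulr1 /=.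
rewrite (onlyM_neq _ _ (@only_xpow _ k a)) ?xpow_nil ?kj ?(eq_sym j) //.
rewrite -rcons_cons F1 // /xvar mulrDr mulr1 pserD F2 // add0r => ->.
by rewrite pXMr_rcons.
Qed.

Lemma syl_strip i j s : i != j -> syl_ok s -> exists a b t,
  [/\ syl_ok t, head j (map fst t) != i, last j (map fst t) != i &
      syl_eval s = xpow i a * syl_eval t * xpow i b].
Proof.
move=> ij sok; have ji : j != i by rewrite eq_sym.
have [a [t [tok th Et]]] : exists a t, [/\ syl_ok t, head j (map fst t) != i &
    syl_eval s = xpow i a * syl_eval t].
  case: s sok => [|[k c] s] sok; first by exists 0, [::]; rewrite mul1r.
  have [ki|ki] := eqVneq k i; last by exists 0, ((k, c) :: s); rewrite mul1r.
  exists c, s; rewrite syl_eval_cons ki; split => //.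
    by have [] := @syl_ok_cat [:: (k, c)] s sok.
  by have /andP[/= + _] := sok; case: (s) => //= x u /andP[+ _]; rewrite ki eq_sym.
case/lastP: t tok th Et => [|t [k c]] tok th Et.
  by exists a, 0, [::]; rewrite mulr1.
have [ki|ki] := eqVneq k i; last first.
  by exists a, 0, (rcons t (k, c)); rewrite mulr1 map_rcons last_rcons; split; rewrite -?map_rcons.
exists a, c, t; split.
- by have [] := @syl_ok_cat t [:: (k, c)]; rewrite ?cats1.
- by move: th; case: (t) => //=.
- have /andP[+ _] := tok; rewrite map_rcons ki.
  by case: (t) => //= x u; rewrite rcons_path => /andP[].
by rewrite Et syl_eval_rcons ki mulrA.
Qed.

(** The relation for [i] gives [h = v h'] with [v] in the free group and [h'] a series in [X_i].
    Writing the conjugate of [u2] by [v^-1] as [x_i^a t x_i^b], the relation for [j] becomes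
    [t (x_i^b h') = (x_i^-a h') x_j], which forces [h' = x_i^a]. *)
Lemma intertwiner_in_free i j h u1 u2 : i != j -> h [::] = 1 ->
  in_free u1 -> in_free u2 -> u1 * h = h * xvar i -> u2 * h = h * xvar j -> in_free h.
Proof.
move=> ij h1 [w1 ->] F2 E1 E2.
have [s1 s1ok Es1] := magnus_syllables w1; rewrite Es1 in E1.
have [v vF Ev] := conj_xvar_in_free s1ok h1 E1.
have v1 := in_free_nil vF; have vu := pser_unit v1.
have [h' hE] : exists h', h = v * h' by exists (v^-1 * h); rewrite mulVKr.
have h'1 : h' [::] = 1 by move: h1; rewrite hE pmul_nil v1 mul1r.
have O : only i h'.
  apply: only_commute; apply: (mulrI vu).
  by rewrite !mulrA -Ev -[in RHS]mulrA -hE E1.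
have F3 : in_free (v^-1 * u2 * v) by apply: in_freeM => //; apply: in_freeM => //; apply: in_freeV.
have E3 : v^-1 * u2 * v * h' = h' * xvar j by rewrite -mulrA -hE -mulrA E2 hE !mulrA mulVr // mul1r.
case: F3 E3 => w3 ->; have [s3 s3ok ->] := magnus_syllables w3.
have [a [b [t [tok th tl ->]]]] := syl_strip ij s3ok => E3.
have au := xpow_unit i a.
suff f21 : (xpow i a)^-1 * h' = 1.
  have -> : h = v * xpow i a.
    by rewrite hE; congr (_ * _); rewrite -[LHS](mulVKr au) f21 mulr1.
  by apply: in_freeM => //; apply: in_free_xpow.
apply: (@only_intertwine i j t (xpow i b * h')) => //.
- by apply: onlyM => //; apply: only_xpow.
- by apply: onlyM => //; apply: onlyV; [apply: xpow_nil | apply: only_xpow].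
- by rewrite pmul_nil xpow_nil h'1 mulr1.
- by rewrite pmul_nil invr_nil ?xpow_nil // h'1 mulr1.
by apply: (mulrI au); rewrite !mulrA mulrV // mul1r -E3.
Qed.
End Conjugation.

(** * Uniqueness of roots up to inner automorphisms *)

Theorem theorem1p1 (N : nat) (hN : 2 <= N) (phi psi : endo N)
  (hphi : is_aut phi) (hpsi : is_aut psi)
  (hphi3 : IA3 phi) (hpsi3 : IA3 psi)
  (k : nat) (hk : 1 <= k)
  (hpow : out_eq (power phi k) (power psi k)) :
  out_eq phi psi.
Proof.
have [g0 Hg0] := hpow.
have Hg i : (iter k (subst (subst_of phi)) (pX i) * magnus g0 =
             magnus g0 * iter k (subst (subst_of psi)) (pX i))%R.
  have E (s : endo N) : (iter k (subst (subst_of s)) (pX i) = magnus (power s k i) - 1)%R.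
    have -> : pX i = (xvar i - 1)%R :> pser 'I_N by rewrite /xvar addrC addKr.
    rewrite iter_substB ?act_power.
    by congr (_ - _)%R; apply: (iter_subst_const (subst_of_nil s)).
  rewrite !E mulrBl mulrBr mul1r mulr1; congr (_ - _)%R.
  have := congr1 (@magnus N) (Hg0 i).
  rewrite !magnus_mul !magnus_reduce magnus_inv => ->.
  by rewrite mulrVK ?magnus_unit.
have [h h1 Hh] := intertwiner_exists (subst_of_nil phi) (subst_of_nil psi)
  (pint_subst_of psi) (fun i j => subst_of_mod3 i j hphi3)
  (fun i j => subst_of_mod3 i j hpsi3) hk (magnus_nil g0) Hg.
have [t Ht] := hpsi.
(* With [t] inverse to [psi], applying the intertwining relation to [t i] shows that [h] conjugates
   each generator into the free group. *)
have Et i : (magnus (apply phi (t i)) * h = h * xvar i)%R.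
  by rewrite -act_magnus Hh act_magnus (proj1 (Ht i)) magnus_gen.
pose i0 := Ordinal (ltnW hN); pose i1 := Ordinal hN.
have [g Eg] : in_free h.
  by apply: (@intertwiner_in_free _ i0 i1 h _ _ _ h1 _ _ (Et i0) (Et i1)) => //; eexists.
exists g => i; apply: magnus_inj; try exact: reduce_reduced.
rewrite !magnus_mul !magnus_reduce magnus_inv -Eg.
by rewrite -act_xvar // -act_xvar // -Hh mulrK // pser_unit.
Qed.
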